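(* Let $k\geq 1$ and $\tau\in\mathbb{C}$, $\tau\neq 0$. Then the group $\operatorname{TAut}_R(\mathbb{C}\overline{Q};c)$ of tame symplectomorphisms acts transitively on $N_{k,\tau}$.
   Context: Quiver: $Q$ has two vertices $1,2$ and arrows $a$ (a loop at $1$), $x$ (from $2$ to $1$), $y$ (from $1$ to $2$). Its double $\overline{Q}$ has in addition arrows $a^\ast,x^\ast,y^\ast$, where $z^\ast$ goes in the direction opposite to $z$. $\mathbb{C}\overline{Q}$ is the path algebra (paths are written from right to left), $\pi_1,\pi_2$ are the trivial paths, $R=\mathbb{C}\pi_1\oplus\mathbb{C}\pi_2$; thus $\pi_1x=x=x\pi_2$, $\pi_2y=y=y\pi_1$, $\pi_2x^\ast=x^\ast=x^\ast\pi_1$, $\pi_1y^\ast=y^\ast=y^\ast\pi_2$, $a,a^\ast\in\pi_1\mathbb{C}\overline{Q}\pi_1$. $\operatorname{Aut}_R(\mathbb{C}\overline{Q};c)$ is the group of algebra automorphisms of $\mathbb{C}\overline{Q}$ which fix $R$ pointwise and fix $c=[a,a^\ast]+[x,x^\ast]+[y,y^\ast]$. Tame symplectomorphisms: an element $\phi\in\operatorname{Aut}_R(\mathbb{C}\overline{Q};c)$ is strictly triangular if $\phi(a)=a$, $\phi(x)=x$, $\phi(y)=y$. Let $\mathrm{Aff}_c=ASL(2,\mathbb{C})\times GL(2,\mathbb{C})\subset\operatorname{Aut}_R(\mathbb{C}\overline{Q};c)$, where the group $ASL(2,\mathbb{C})$ of unimodular affine transformations of $\mathbb{C}^2$ acts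 in the usual way on $\operatorname{span}(a,a^\ast)$ (translations being by multiples of $\pi_1$) and trivially on $x,y,x^\ast,y^\ast$, while $T\in GL(2,\mathbb{C})$ acts trivially on $a,a^\ast$ and by $\begin{pmatrix}-x\\ y^\ast\end{pmatrix}\mapsto T\begin{pmatrix}-x\\ y^\ast\end{pmatrix}$, $\begin{pmatrix}x^\ast & y\end{pmatrix}\mapsto\begin{pmatrix}x^\ast & y\end{pmatrix}T^{-1}$. $\operatorname{TAut}_R(\mathbb{C}\overline{Q};c)$ is the subgroup of $\operatorname{Aut}_R(\mathbb{C}\overline{Q};c)$ generated by the strictly triangular automorphisms and $\mathrm{Aff}_c$. Variety: $N_{k,\tau}=\{(A,B,i,j)\in M_{k,k}\times M_{k,k}\times M_{k,2}\times M_{2,k}:\ [A,B]-ij=\tau\cdot 1\}/GL(k,\mathbb{C})$, where $M_{p,q}$ is the space of complex $p\times q$ matrices and $g\in GL(k,\mathbb{C})$ acts by $(gAg^{-1},gBg^{-1},gi,jg^{-1})$. Write $i=(i_1,i_2)$ (columns), $j=\begin{pmatrix}j_1\\ j_2\end{pmatrix}$ (rows). Action: a quadruple $(A,B,i,j)$ is identified with the representation $\rho$ of $\mathbb{C}\overline{Q}$ on $\mathbb{C}^k\oplus\mathbb{C}$ given by $a\mapsto A$, $a^\ast\mapsto B$, $x\mapsto -i_1$, $x^\ast\mapsto j_1$, $y\mapsto j_2$, $y^\ast\mapsto i_2$, and $\phi$ acts by $\rho\mapsto\rho\circ\phi$. For $\phi\in\operatorname{Aut}_R(\mathbb{C}\overline{Q};c)$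 this preserves $[A,B]-ij=\tau\cdot1$, commutes with $GL(k,\mathbb{C})$, and so induces an action on $N_{k,\tau}$. *)

(* Defs.v *)
From HB Require Import structures.
From mathcomp Require Import all_boot all_order all_algebra.
From mathcomp Require Import boolp classical_sets.
From mathcomp.finmap Require Import finmap.
From mathcomp.multinomials Require Import monalg.

Set Implicit Arguments.
Unset Strict Implicit.
Unset Printing Implicit Defensive.

Import GRing.Theory.

Local Open Scope ring_scope.

HB.lock Definition linext (F : fieldType) (K : choiceType) (V : lmodType F)
    (f : K -> V) (u : {malg F[K]}) : V :=
  \sum_(p <- msupp u) u@_p *: f p.

Section LinExt.
Context (F : fieldType) (K : choiceType) (V : lmodType F).
Implicit Types (f : K -> V) (u v : {malg F[K]}).

Lemma linextw f u (d : {fset K}) : (msupp u `<=` d)%fset ->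
  linext f u = \sum_(p <- d) u@_p *: f p.
Proof.
move=> le_ud; rewrite linext.unlock (big_fset_incl _ le_ud) // => p _.
by rewrite -mcoeff_eq0 => /eqP ->; rewrite scale0r.
Qed.

Lemma linext_is_linear f : linear (linext f).
Proof.
move=> c u v; set d := (msupp u `|` msupp v `|` msupp (c *: u + v))%fset.
rewrite !(@linextw f _ d); last 3 first.
- by apply/fsubsetP=> p pu; rewrite !inE pu ?orbT.
- by apply/fsubsetP=> p pu; rewrite !inE pu ?orbT.
- by apply/fsubsetP=> p pu; rewrite !inE pu ?orbT.
rewrite scaler_sumr -big_split; apply: eq_bigr => p _ /=.
by rewrite mcoeffD mcoeffZ scalerDl scalerA.
Qed.

HB.instance Definition _ f :=
  GRing.isLinear.Build F {malg F[K]} V _ (linext f) (linext_is_linear f).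

Lemma linextU f p : linext f << p >> = f p.
Proof.
rewrite (@linextw f _ [fset p]%fset) ?msuppU_le // big_seq_fset1.
by rewrite mcoeffUU scale1r.
Qed.

Lemma linext_uniq (g h : {malg F[K]} -> V) : linear g -> linear h ->
  (forall p, g << p >> = h << p >>) -> g =1 h.
Proof.
move=> lg lh gh u.
pose gL : {linear _ -> _} := HB.pack g (GRing.isLinear.Build _ _ _ _ g lg).
pose hL : {linear _ -> _} := HB.pack h (GRing.isLinear.Build _ _ _ _ h lh).
have E p : << u@_p *g p >> = u@_p *: << p >> :> {malg F[K]}.
  by apply/malgP => q; rewrite mcoeffZ !mcoeffU mulrnAr mulr1.
rewrite (monalgE u) -[LHS]/(gL _) -[RHS]/(hL _) !linear_sum.
by apply: eq_bigr => p _; rewrite E !linearZ_LR; congr (_ *: _); exact: gh.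
Qed.

Lemma linear_scal (U W : lmodType F) (f : U -> W) :
  linear f -> forall c (u : U), f (c *: u) = c *: f u.
Proof.
move=> lf c u.
have f0 : f 0 = 0 by have := lf (-1) 0 0; rewrite scaler0 addr0 scaleN1r addNr.
by have := lf c u 0; rewrite f0 !addr0.
Qed.

End LinExt.

Record quiver := Quiver {
  vertex : finType;
  arrow : choiceType;
  src : arrow -> vertex;
  tgt : arrow -> vertex
}.

(* inl z is the arrow z itself, inr z is the reversed arrow z^*. *)
Definition double (Q : quiver) : quiver :=
  @Quiver (vertex Q) (arrow Q + arrow Q)%type
    (fun z => match z with inl z => src z | inr z => tgt z end)
    (fun z => match z with inl z => tgt z | inr z => src z end).

Section Paths.
Context (Q : quiver).
Implicit Types (v : vertex Q) (s : seq (arrow Q)).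

(* Paths are words written from right to left, so the head of a word is its
   last arrow; the end vertex of the path is recorded too, which accounts for
   the trivial paths. *)
Fixpoint composable v s :=
  if s is z :: s' then (tgt z == v) && composable (src z) s' else true.

Record qpath := QPath {
  pval : vertex Q * seq (arrow Q);
  _ : composable pval.1 pval.2
}.

HB.instance Definition _ := [isSub for pval].
HB.instance Definition _ := [Choice of qpath by <:].

Definition ptgt (p : qpath) : vertex Q := (pval p).1.
Definition pword (p : qpath) : seq (arrow Q) := (pval p).2.
Definition psrc (p : qpath) : vertex Q := last (ptgt p) [seq src z | z <- pword p].

Definition ptriv v : qpath := @QPath (v, [::]) isT.

Lemma parrow_subproof (z : arrow Q) : composable (tgt z) [:: z].
Proof. by rewrite /= eqxx. Qed.

Definition parrow (z : arrow Q) : qpath :=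
  @QPath (tgt z, [:: z]) (parrow_subproof z).

Definition pcat (p q : qpath) : option qpath :=
  if psrc p == ptgt q then insub (ptgt p, pword p ++ pword q) else None.

Lemma composable_cat v s1 s2 :
  composable v (s1 ++ s2) =
    composable v s1 && composable (last v [seq src z | z <- s1]) s2.
Proof.
by elim: s1 v => [|z s1 IH] v //=; rewrite IH andbA.
Qed.

Lemma qpath_inj (p q : qpath) : ptgt p = ptgt q -> pword p = pword q -> p = q.
Proof.
move=> e1 e2; apply/val_inj; case: p q e1 e2 => -[t s] ? [[t' s'] ?].
by rewrite /ptgt /pword /= => -> ->.
Qed.

Lemma pcatP p q : psrc p = ptgt q ->
  exists2 r, pcat p q = Some r &
    [/\ ptgt r = ptgt p, pword r = pword p ++ pword q & psrc r = psrc q].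
Proof.
move=> e; rewrite /pcat e eqxx.
have H : composable (ptgt p) (pword p ++ pword q).
  rewrite composable_cat; apply/andP; split; first exact: (valP p).
  by rewrite -/(psrc p) e; exact: (valP q).
exists (@QPath (ptgt p, pword p ++ pword q) H).
  by rewrite insubT.
split=> //; rewrite {1}/psrc /= map_cat last_cat -/(psrc p) e.
by [].
Qed.

Lemma pcatN p q : psrc p != ptgt q -> pcat p q = None.
Proof. by rewrite /pcat => /negbTE ->. Qed.

Lemma pcat1p p q : pcat p q <> None -> psrc p = ptgt q.
Proof. by rewrite /pcat; case: eqP. Qed.

End Paths.

Definition pathalg (Q : quiver) (F : fieldType) := {malg F[qpath Q]}.
HB.instance Definition _ (Q : quiver) (F : fieldType) :=
  GRing.Lmodule.on (pathalg Q F).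

HB.lock Definition pbasis (Q : quiver) (F : fieldType) (p : qpath Q) :
  pathalg Q F := << p >>.

Section PathAlgebra.
Context (Q : quiver) (F : fieldType).
Implicit Types (v : vertex Q) (p q r : qpath Q).
Local Notation pathalg := (pathalg Q F).
Local Notation pbasis := (@pbasis Q F).

Lemma pbasisE p : pbasis p = << p >>.
Proof. by rewrite unlock. Qed.

Definition pmul1 (p q : qpath Q) : pathalg :=
  if pcat p q is Some r then pbasis r else 0.

Definition pmul (u w : pathalg) : pathalg :=
  linext (fun p => linext (fun q => pmul1 p q) w) u.

Definition pone : pathalg := \sum_v pbasis (ptriv v).

Lemma pmulE p q : pmul (pbasis p) (pbasis q) = pmul1 p q.
Proof. by rewrite /pmul !pbasisE !linextU. Qed.

Lemma pmul_linl w : linear (pmul^~ w).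
Proof. by move=> c u1 u2; rewrite /pmul linearP. Qed.

Lemma linext_fun_linear (f g : qpath Q -> pathalg) c (u : pathalg) :
  linext (fun p => c *: f p + g p) u = c *: linext f u + linext g u.
Proof.
rewrite linext.unlock scaler_sumr -big_split /=; apply: eq_bigr => p _.
by rewrite scalerDr !scalerA mulrC.
Qed.

Lemma pmul_linr u : linear (pmul u).
Proof.
move=> c w1 w2; rewrite -[RHS]linext_fun_linear.
by congr (linext _ u); apply/funext => p; rewrite linearP.
Qed.

Lemma pmul0l w : pmul 0 w = 0.
Proof. by rewrite /pmul linear0. Qed.

Lemma pmul0r u : pmul u 0 = 0.
Proof.
by have := pmul_linr u (-1) 0 0; rewrite scaler0 addr0 scaleN1r addNr.
Qed.

Lemma pmulA1 p q r :
  pmul (pbasis p) (pmul1 q r) = pmul (pmul1 p q) (pbasis r).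
Proof.
rewrite /pmul1; have [e1|n1] := eqVneq (psrc p) (ptgt q); last first.
  rewrite (pcatN n1) pmul0l.
  have [e2|n2] := eqVneq (psrc q) (ptgt r); last by rewrite (pcatN n2) pmul0r.
  have [qr -> [t _ _]] := pcatP e2.
  by rewrite pmulE /pmul1 pcatN // t.
have [pq -> [tpq wpq spq]] := pcatP e1.
rewrite pmulE; have [e2|n2] := eqVneq (psrc q) (ptgt r); last first.
  by rewrite (pcatN n2) pmul0r /pmul1 pcatN // spq.
have [qr -> [tqr wqr sqr]] := pcatP e2.
rewrite pmulE /pmul1.
have [|x -> [tx wx sx]] := @pcatP _ p qr; first by rewrite tqr.
have [|y -> [ty wy sy]] := @pcatP _ pq r; first by rewrite spq.
congr pbasis; apply: qpath_inj; first by rewrite tx ty.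
by rewrite wx wy wqr wpq catA.
Qed.

Lemma pmulA : associative pmul.
Proof.
move=> u v w.
have lc (f g : pathalg -> pathalg) : linear f -> linear g -> linear (f \o g).
  by move=> lf lg c x y /=; rewrite lg lf.
refine (@linext_uniq _ _ _ (fun u : pathalg => pmul u (pmul v w))
                    (fun u : pathalg => pmul (pmul u v) w) _ _ _ u).
- exact: pmul_linl.
- exact: (lc (pmul^~ w) (pmul^~ v) (pmul_linl w) (pmul_linl v)).
move=> p /=.
refine (@linext_uniq _ _ _ (fun v : pathalg => pmul << p >> (pmul v w))
                    (fun v : pathalg => pmul (pmul << p >> v) w) _ _ _ v).
- exact: (lc _ (pmul^~ w) (pmul_linr _) (pmul_linl w)).
- exact: (lc (pmul^~ w) _ (pmul_linl w) (pmul_linr _)).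
move=> q /=.
refine (@linext_uniq _ _ _ (fun w : pathalg => pmul << p >> (pmul << q >> w))
                    (fun w : pathalg => pmul (pmul << p >> << q >>) w) _ _ _ w).
- exact: (lc _ _ (pmul_linr _) (pmul_linr _)).
- exact: pmul_linr.
by move=> r /=; rewrite -!pbasisE !pmulE pmulA1.
Qed.

Lemma pmul_trivl v p :
  pmul (pbasis (ptriv v)) (pbasis p) = if v == ptgt p then pbasis p else 0.
Proof.
rewrite pmulE /pmul1; case: (eqVneq v (ptgt p)) => [e|n]; last first.
  by rewrite pcatN.
have [//|r -> [t w _]] := @pcatP _ (ptriv v) p.
by congr pbasis; apply: qpath_inj; rewrite ?t ?w.
Qed.

Lemma pmul_trivr v p :
  pmul (pbasis p) (pbasis (ptriv v)) = if v == psrc p then pbasis p else 0.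
Proof.
rewrite pmulE /pmul1; case: (eqVneq v (psrc p)) => [e|n]; last first.
  by rewrite pcatN // eq_sym.
have [//|r -> [t w _]] := @pcatP _ p (ptriv v).
by congr pbasis; apply: qpath_inj; rewrite ?t ?w //= cats0.
Qed.

Lemma pmul1u : left_id pone pmul.
Proof.
apply: (linext_uniq (g := pmul pone) (h := id)); [exact: pmul_linr|by []|].
move=> p; rewrite -pbasisE /pone.
pose f : {linear pathalg -> pathalg} :=
  HB.pack (pmul^~ (pbasis p)) (GRing.isLinear.Build _ _ _ _ _ (pmul_linl (pbasis p))).
rewrite -[LHS]/(f _) linear_sum /= (eq_bigr _ (fun v _ => pmul_trivl v p)).
by rewrite -big_mkcond big_pred1_eq.
Qed.

Lemma pmulu1 : right_id pone pmul.
Proof.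
apply: (linext_uniq (g := pmul^~ pone) (h := id)); [exact: pmul_linl|by []|].
move=> p; rewrite -pbasisE /pone.
pose f : {linear pathalg -> pathalg} :=
  HB.pack (pmul (pbasis p)) (GRing.isLinear.Build _ _ _ _ _ (pmul_linr (pbasis p))).
rewrite -[LHS]/(f _) linear_sum /= (eq_bigr _ (fun v _ => pmul_trivr v p)).
by rewrite -big_mkcond big_pred1_eq.
Qed.

Lemma pmulDl : left_distributive pmul +%R.
Proof. by move=> u v w; have := pmul_linl w 1 u v; rewrite !scale1r. Qed.

Lemma pmulDr : right_distributive pmul +%R.
Proof. by move=> u v w; have := pmul_linr u 1 v w; rewrite !scale1r. Qed.

HB.instance Definition _ :=
  GRing.Zmodule_isPzRing.Build pathalg pmulA pmul1u pmulu1 pmulDl pmulDr.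

Lemma pathalgZl (c : F) (u w : pathalg) : c *: (u * w) = (c *: u) * w.
Proof. exact: esym (linear_scal (pmul_linl w) c u). Qed.

Lemma pathalgZr (c : F) (u w : pathalg) : c *: (u * w) = u * (c *: w).
Proof. exact: esym (linear_scal (pmul_linr u) c w). Qed.

Definition pi_ v : pathalg := pbasis (ptriv v).
Definition arr (z : arrow Q) : pathalg := pbasis (parrow z).

End PathAlgebra.

Section PathAlgebraTheory.
Context (Q : quiver) (F : fieldType).
Local Notation A := (pathalg Q F).
Local Notation pi_ := (@pi_ Q F).
Local Notation arr := (@arr Q F).

Lemma pi_mul v w : pi_ v * pi_ w = if v == w then pi_ v else 0.
Proof. by rewrite [LHS]pmul_trivl; case: eqVneq => // ->. Qed.

Lemma sum_pi : \sum_v pi_ v = 1.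
Proof. by []. Qed.

Lemma pi_arr z : pi_ (tgt z) * arr z = arr z.
Proof. by rewrite [LHS]pmul_trivl eqxx. Qed.

Lemma arr_pi z : arr z * pi_ (src z) = arr z.
Proof. by rewrite [LHS]pmul_trivr eqxx. Qed.

Lemma pbasis_prod (p : qpath Q) :
  pbasis F p = pi_ (ptgt p) * foldr (fun z (u : A) => arr z * u) 1 (pword p).
Proof.
case: p => -[t s] /= sP; elim: s t sP => [|z s IH] t sP.
  by rewrite /= mulr1; congr pbasis; apply: qpath_inj.
have /andP[/eqP tz sP'] : (tgt z == t) && composable (src z) s by [].
rewrite /ptgt /pword /=; subst t; rewrite mulrA pi_arr -arr_pi -mulrA.
move: (IH _ sP'); rewrite /ptgt /pword /= => <-.
rewrite [RHS]pmulE /pmul1.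
have [//|r -> [tr wr _]] := @pcatP _ (parrow z) (@QPath Q (src z, s) sP').
by congr pbasis; apply: qpath_inj; rewrite ?tr ?wr.
Qed.

Lemma pathalg_morph_uniq n (f g : A -> 'M[F]_n) :
  linear f -> linear g -> GRing.monoid_morphism f -> GRing.monoid_morphism g ->
  (forall v, f (pi_ v) = g (pi_ v)) -> (forall z, f (arr z) = g (arr z)) ->
  f =1 g.
Proof.
move=> lf lg [f1 fM] [g1 gM] fgpi fgarr; apply: linext_uniq => // p.
rewrite -pbasisE pbasis_prod fM gM fgpi; congr (_ * _).
by elim: (pword p) => [|z s IH] /=; rewrite ?f1 ?g1 // fM gM fgarr IH.
Qed.

(* This is an algebra morphism only under the conditions of section QRep. *)
Definition qrep n (e : vertex Q -> 'M[F]_n) (m : arrow Q -> 'M[F]_n) : A -> 'M[F]_n :=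
  linext (fun p => e (ptgt p) *m foldr (fun z M => m z *m M) 1%:M (pword p)).

Section QRep.
Context (n : nat) (e : vertex Q -> 'M[F]_n) (m : arrow Q -> 'M[F]_n).
Context (e_orth : forall v w, e v *m e w = if v == w then e v else 0).
Context (e_sum : \sum_v e v = 1%:M).
Context (m_tgt : forall z, e (tgt z) *m m z = m z).
Context (m_src : forall z, m z *m e (src z) = m z).

Lemma qrep_linear : linear (qrep e m).
Proof. exact: linext_is_linear. Qed.

Lemma qrep_basis p :
  qrep e m (pbasis F p) = e (ptgt p) *m foldr (fun z M => m z *m M) 1%:M (pword p).
Proof. by rewrite pbasisE; exact: linextU. Qed.

Lemma qrep_pi v : qrep e m (pi_ v) = e v.
Proof. by rewrite qrep_basis /= mulmx1. Qed.

Lemma qrep_arr z : qrep e m (arr z) = m z.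
Proof. by rewrite qrep_basis /= mulmx1 m_tgt. Qed.

Lemma qrep_src p : qrep e m (pbasis F p) *m e (psrc p) = qrep e m (pbasis F p).
Proof.
rewrite qrep_basis /psrc; case: p => -[t s] /= sP.
rewrite /ptgt /pword /=; elim: s t sP => [|z s IH] t sP.
  by rewrite /= mulmx1 e_orth eqxx.
have /andP[/eqP tz sP'] : (tgt z == t) && composable (src z) s by [].
subst t; have := IH _ sP'; rewrite -mulmxA => IH'.
rewrite [LHS]/= [RHS]/=. rewrite -[m z]m_src. rewrite -!mulmxA. by rewrite IH'.
Qed.

Lemma qrep_monoid : GRing.monoid_morphism (qrep e m).
Proof.
split.
  pose f : {linear A -> 'M[F]_n} :=
    HB.pack (qrep e m) (GRing.isLinear.Build _ _ _ _ _ qrep_linear).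
  rewrite -sum_pi -[LHS]/(f _) linear_sum.
  by rewrite (eq_bigr _ (fun v _ => qrep_pi v)) e_sum.
have M1 p q : qrep e m (pmul1 F p q) = qrep e m (pbasis F p) *m qrep e m (pbasis F q).
  rewrite /pmul1; have [E|N] := eqVneq (psrc p) (ptgt q); last first.
    rewrite (pcatN N) -(qrep_src p) [qrep e m (pbasis F q)]qrep_basis.
    by rewrite -mulmxA [e _ *m (e _ *m _)]mulmxA e_orth (negbTE N) mul0mx mulmx0
               /qrep linear0.
  have [r -> [tr wr _]] := pcatP E.
  rewrite -(qrep_src p) E [qrep e m (pbasis F q)]qrep_basis.
  rewrite -mulmxA [e _ *m (e _ *m _)]mulmxA e_orth eqxx mulmxA -E qrep_src.
  rewrite !qrep_basis tr wr -mulmxA; congr (_ *m _).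
  by elim: (pword p) => [|z s IH] /=; rewrite ?mul1mx // IH mulmxA.
have lm x : linear (fun y : 'M[F]_n => x *m y) by move=> c y y'; rewrite linearP.
have rm x : linear (fun y : 'M[F]_n => y *m x).
  by move=> c y y'; rewrite mulmxDl scalemxAl.
have lr := qrep_linear.
move=> u w.
refine (@linext_uniq _ _ _ (fun u : A => qrep e m (pmul u w))
  (fun u => qrep e m u *m qrep e m w) _ _ _ u).
- by move=> c x y; rewrite (pmul_linl w c x y) lr.
- by move=> c x y; rewrite lr rm.
move=> p /=.
refine (@linext_uniq _ _ _ (fun w : A => qrep e m (pmul << p >> w))
  (fun w => qrep e m << p >> *m qrep e m w) _ _ _ w).
- by move=> c x y; rewrite (pmul_linr _ c x y) lr.
- by move=> c x y; rewrite lr lm.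
by move=> q /=; rewrite -!pbasisE pmulE M1.
Qed.

End QRep.
End PathAlgebraTheory.

Inductive Qarrow := Qa | Qx | Qy.

Definition Qarrow_ord (z : Qarrow) : 'I_3 :=
  match z with Qa => inord 0 | Qx => inord 1 | Qy => inord 2 end.
Definition ord_Qarrow (i : 'I_3) : Qarrow := nth Qa [:: Qa; Qx; Qy] i.
Lemma Qarrow_ordK : cancel Qarrow_ord ord_Qarrow.
Proof. by case; rewrite /ord_Qarrow /= inordK. Qed.
HB.instance Definition _ := Finite.copy Qarrow (can_type Qarrow_ordK).

(* The vertices 1 and 2 are the elements ord0 and ord_max of 'I_2. *)
Definition Qfig : quiver :=
  @Quiver 'I_2 Qarrow
    (fun z => match z with Qx => ord_max | _ => ord0 end)
    (fun z => match z with Qy => ord_max | _ => ord0 end).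

Definition CQ (F : fieldType) := pathalg (double Qfig) F.
HB.instance Definition _ (F : fieldType) := GRing.Lmodule.on (CQ F).
HB.instance Definition _ (F : fieldType) := GRing.PzRing.on (CQ F).

Lemma CQ_oner_neq0 (F : fieldType) : (1 : CQ F) != 0.
Proof.
apply/eqP => /(congr1 (fun u : CQ F => u * pi_ F (ord0 : vertex (double Qfig)))).
rewrite /= mul1r mul0r /pi_ pbasisE => /eqP.
by rewrite monalgU_eq0 oner_eq0.
Qed.

HB.instance Definition _ (F : fieldType) :=
  GRing.PzSemiRing_isNonZero.Build (CQ F) (@CQ_oner_neq0 F).
HB.instance Definition _ (F : fieldType) :=
  GRing.Lmodule_isLalgebra.Build F (CQ F) (@pathalgZl (double Qfig) F).
HB.instance Definition _ (F : fieldType) :=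
  GRing.Lalgebra_isAlgebra.Build F (CQ F) (@pathalgZr (double Qfig) F).

Section Generators.
Context {F : fieldType}.
Definition g_pi1 : CQ F := pi_ F (ord0 : vertex (double Qfig)).
Definition g_pi2 : CQ F := pi_ F (ord_max : vertex (double Qfig)).
Definition g_a  : CQ F := arr F (inl Qa : arrow (double Qfig)).
Definition g_x  : CQ F := arr F (inl Qx : arrow (double Qfig)).
Definition g_y  : CQ F := arr F (inl Qy : arrow (double Qfig)).
Definition g_as : CQ F := arr F (inr Qa : arrow (double Qfig)).
Definition g_xs : CQ F := arr F (inr Qx : arrow (double Qfig)).
Definition g_ys : CQ F := arr F (inr Qy : arrow (double Qfig)).

Definition comm (u v : CQ F) : CQ F := u * v - v * u.

Definition c_elt : CQ F := comm g_a g_as + comm g_x g_xs + comm g_y g_ys.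
End Generators.

Section AutRc.
Context (F : fieldType).
Local Notation A := (CQ F).

Record is_autRc (phi : A -> A) : Prop := IsAutRc {
  autRc_linear : linear phi;
  autRc_monoid : GRing.monoid_morphism phi;
  autRc_bij : bijective phi;
  autRc_fixR : forall s t : F,
    phi (s *: g_pi1 + t *: g_pi2) = s *: g_pi1 + t *: g_pi2;
  autRc_fixc : phi c_elt = c_elt
}.

Record autRc := AutRc { autRc_fun :> A -> A; autRcP : is_autRc autRc_fun }.

Lemma autRc_eq (phi psi : autRc) : phi =1 psi -> phi = psi.
Proof.
case: phi psi => [f fP] [g gP] /= /funext e; move: fP gP; rewrite e => fP gP.
by congr AutRc; exact: Prop_irrelevance.
Qed.

HB.instance Definition _ := gen_eqMixin autRc.
HB.instance Definition _ := gen_choiceMixin autRc.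

HB.instance Definition _ (phi : autRc) :=
  GRing.isLinear.Build F A A _ (phi : A -> A) (autRc_linear (autRcP phi)).
HB.instance Definition _ (phi : autRc) :=
  GRing.isMonoidMorphism.Build A A (phi : A -> A) (autRc_monoid (autRcP phi)).

Lemma is_autRc_id : is_autRc id.
Proof. by split=> //; exists id. Qed.

Lemma is_autRc_comp (phi psi : autRc) : is_autRc (phi \o psi).
Proof.
split.
- exact: linearP.
- by split=> [|u v] /=; rewrite ?(autRc_monoid (autRcP psi)) ?(autRc_monoid (autRcP phi)).
- exact: bij_comp (autRc_bij (autRcP phi)) (autRc_bij (autRcP psi)).
- by move=> s t /=; rewrite (autRc_fixR (autRcP psi)) (autRc_fixR (autRcP phi)).
- by rewrite /= (autRc_fixc (autRcP psi)) (autRc_fixc (autRcP phi)).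
Qed.

Lemma is_autRc_inv (phi : autRc) :
  exists psi : autRc, cancel phi psi /\ cancel psi phi.
Proof.
case: (autRc_bij (autRcP phi)) => g fK gK.
have I : injective phi := can_inj fK.
suff gP : is_autRc g by exists (AutRc gP).
split.
- by move=> c u v; apply: I; rewrite (autRc_linear (autRcP phi)) !gK.
- split=> [|u v]; apply: I; rewrite gK.
    by rewrite (autRc_monoid (autRcP phi)).
  by rewrite (autRc_monoid (autRcP phi)) !gK.
- by exists phi.
- by move=> s t; apply: I; rewrite gK (autRc_fixR (autRcP phi)).
- by apply: I; rewrite gK (autRc_fixc (autRcP phi)).
Qed.

Definition autRc_one : autRc := AutRc is_autRc_id.
Definition autRc_mul (phi psi : autRc) : autRc := AutRc (is_autRc_comp phi psi).
Definition autRc_inv (phi : autRc) : autRc := projT1 (cid (is_autRc_inv phi)).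

Lemma autRc_invK (phi : autRc) : cancel phi (autRc_inv phi).
Proof. by rewrite /autRc_inv; case: cid => psi []. Qed.
Lemma autRc_Kinv (phi : autRc) : cancel (autRc_inv phi) phi.
Proof. by rewrite /autRc_inv; case: cid => psi []. Qed.

Lemma autRc_mulA : associative autRc_mul.
Proof. by move=> phi psi chi; apply: autRc_eq. Qed.
Lemma autRc_mul1 : left_id autRc_one autRc_mul.
Proof. by move=> phi; apply: autRc_eq. Qed.
Lemma autRc_mulr1 : right_id autRc_one autRc_mul.
Proof. by move=> phi; apply: autRc_eq. Qed.
Lemma autRc_mulV : left_inverse autRc_one autRc_inv autRc_mul.
Proof. by move=> phi; apply: autRc_eq => u /=; rewrite autRc_invK. Qed.
Lemma autRc_mulrV : right_inverse autRc_one autRc_inv autRc_mul.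
Proof. by move=> phi; apply: autRc_eq => u /=; rewrite autRc_Kinv. Qed.

HB.instance Definition _ := isGroup.Build autRc
  autRc_mulA autRc_mul1 autRc_mulr1 autRc_mulV autRc_mulrV.

Definition strictly_triangular : set autRc :=
  [set phi | [/\ phi g_a = g_a, phi g_x = g_x & phi g_y = g_y]].

(* An automorphism fixing R is determined by its values on the arrows, so the
   element of Aff_c attached to ((S, t), T) is described by these values. *)
Definition affine_by (S : 'M[F]_2) (t : 'cV[F]_2) (T : 'M[F]_2) (phi : autRc) :=
  [/\ phi g_a = S 0 0 *: g_a + S 0 1 *: g_as + t 0 0 *: g_pi1,
      phi g_as = S 1 0 *: g_a + S 1 1 *: g_as + t 1 0 *: g_pi1 &
   [/\ phi (- g_x) = T 0 0 *: - g_x + T 0 1 *: g_ys,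
       phi g_ys = T 1 0 *: - g_x + T 1 1 *: g_ys,
       phi g_xs = (invmx T) 0 0 *: g_xs + (invmx T) 1 0 *: g_y &
       phi g_y = (invmx T) 0 1 *: g_xs + (invmx T) 1 1 *: g_y]].

Definition Affc : set autRc :=
  [set phi | exists S t T, [/\ \det S = 1, T \in unitmx & affine_by S t T phi]].

Definition TAut : set autRc :=
  smallest (fun H : set autRc => group_closed (mem H))
           (strictly_triangular `|` Affc)%classic.

End AutRc.

Section Variety.
Context (F : fieldType) (k : nat).

Definition quad := ('M[F]_k * 'M[F]_k * 'M[F]_(k, 2) * 'M[F]_(2, k))%type.

Definition moment (q : quad) : 'M[F]_k :=
  let: (A, B, i, j) := q in A *m B - B *m A - i *m j.

Definition gl_act (g : 'M[F]_k) (q : quad) : quad :=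
  let: (A, B, i, j) := q in
  (g *m A *m invmx g, g *m B *m invmx g, g *m i, j *m invmx g).

Definition rep_vertex (v : vertex (double Qfig)) : 'M[F]_(k + 1) :=
  if v == ord0 then block_mx 1%:M 0 0 0 else block_mx 0 0 0 1%:M.

Definition rep_arrow (q : quad) (z : arrow (double Qfig)) : 'M[F]_(k + 1) :=
  let: (A, B, i, j) := q in
  match z with
  | inl Qa => block_mx A 0 0 0
  | inr Qa => block_mx B 0 0 0
  | inl Qx => block_mx 0 (- col 0 i) 0 0
  | inr Qx => block_mx 0 0 (row 0 j) 0
  | inl Qy => block_mx 0 0 (row 1 j) 0
  | inr Qy => block_mx 0 (col 1 i) 0 0
  end.

Definition rep (q : quad) : CQ F -> 'M[F]_(k + 1) := qrep rep_vertex (rep_arrow q).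

(* The quadruple whose representation is rep q \o phi, see act_rep below. *)
Definition act (phi : autRc F) (q : quad) : quad :=
  let rho u := rep q (phi u) in
  (ulsubmx (rho g_a), ulsubmx (rho g_as),
   row_mx (- ursubmx (rho g_x)) (ursubmx (rho g_ys)) : 'M_(k, 1 + 1),
   col_mx (dlsubmx (rho g_xs)) (dlsubmx (rho g_y)) : 'M_(1 + 1, k)).

Lemma rep_vertex_orth v w :
  rep_vertex v *m rep_vertex w = if v == w then rep_vertex v else 0.
Proof.
rewrite /rep_vertex; case: v w => [[|[|//]] v] [[|[|//]] w] /=;
  rewrite mulmx_block ?(mulmx0, mul0mx, mulmx1, addr0, add0r) //.
- by rewrite /block_mx !row_mx0 col_mx0.
- by rewrite /block_mx !row_mx0 col_mx0.
Qed.

Lemma rep_vertex_sum : \sum_v rep_vertex v = 1%:M.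
Proof.
rewrite big_ord_recl big_ord1 /rep_vertex /= add_block_mx.
by rewrite ?(addr0, add0r) -scalar_mx_block.
Qed.

Lemma rep_arrow_tgt q z : rep_vertex (tgt z) *m rep_arrow q z = rep_arrow q z.
Proof.
by case: q => [[[A B] i] j]; case: z => -[]; rewrite /rep_vertex /= mulmx_block
  ?(mulmx0, mul0mx, mul1mx, addr0, add0r).
Qed.

Lemma rep_arrow_src q z : rep_arrow q z *m rep_vertex (src z) = rep_arrow q z.
Proof.
by case: q => [[[A B] i] j]; case: z => -[]; rewrite /rep_vertex /= mulmx_block
  ?(mulmx0, mul0mx, mulmx1, addr0, add0r).
Qed.

Lemma rep_linear q : linear (rep q).
Proof. exact: qrep_linear. Qed.

Lemma rep_monoid q : GRing.monoid_morphism (rep q).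
Proof.
exact: (qrep_monoid rep_vertex_orth rep_vertex_sum (rep_arrow_src q)).
Qed.

Lemma rep_pi q v : rep q (pi_ F v) = rep_vertex v.
Proof. exact: qrep_pi. Qed.

Lemma rep_arr q z : rep q (arr F z) = rep_arrow q z.
Proof. exact: (qrep_arr (rep_arrow_tgt q)). Qed.

Lemma autRc_pi (phi : autRc F) v : phi (pi_ F v) = pi_ F v.
Proof.
have E (s t : F) := autRc_fixR (autRcP phi) s t.
have [->|->] : v = ord0 \/ v = ord_max.
- by case: v => -[|[|//]] ?; [left|right]; exact: val_inj.
- by have := E 1 0; rewrite scale1r scale0r addr0.
- by have := E 0 1; rewrite scale1r scale0r add0r.
Qed.

Lemma rep_block q (phi : autRc F) z :
  rep q (phi (arr F z)) =
    rep_vertex (tgt z) *m rep q (phi (arr F z)) *m rep_vertex (src z).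
Proof.
have fixpi := autRc_pi phi.
have mm := (rep_monoid q).2; have pp := (autRc_monoid (autRcP phi)).2.
have e : arr F z = (pi_ F (tgt z) : CQ F) * (arr F z : CQ F) * (pi_ F (src z) : CQ F).
  by rewrite [X in X * _]pi_arr [RHS]arr_pi.
have E : phi (arr F z) =
    (pi_ F (tgt z) : CQ F) * phi (arr F z) * (pi_ F (src z) : CQ F).
  by rewrite -[X in _ = X * _ * _]fixpi -[X in _ = _ * X]fixpi -!pp -e.
by rewrite {1}E !mm !rep_pi.
Qed.

Lemma col_row_mx (X Y : 'M[F]_(k, 1)) :
  (col 0 (row_mx X Y : 'M_(k, 2)) = X) * (col 1 (row_mx X Y : 'M_(k, 2)) = Y).
Proof.
have e0 : (0 : 'I_2) = lshift 1 (0 : 'I_1) by exact: val_inj.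
have e1 : (1 : 'I_2) = rshift 1 (0 : 'I_1) by exact: val_inj.
split; apply/matrixP => a b; rewrite mxE ?e0 ?e1 ?(ord1 b).
  exact: row_mxEl.
exact: row_mxEr.
Qed.

Lemma row_col_mx (X Y : 'M[F]_(1, k)) :
  (row 0 (col_mx X Y : 'M_(2, k)) = X) * (row 1 (col_mx X Y : 'M_(2, k)) = Y).
Proof.
have e0 : (0 : 'I_2) = lshift 1 (0 : 'I_1) by exact: val_inj.
have e1 : (1 : 'I_2) = rshift 1 (0 : 'I_1) by exact: val_inj.
split; apply/matrixP => a b; rewrite mxE ?e0 ?e1 ?(ord1 a).
  exact: col_mxEu.
exact: col_mxEd.
Qed.

Lemma rep_act_arrow (phi : autRc F) q z :
  rep_arrow (act phi q) z = rep q (phi (arr F z)).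
Proof.
rewrite rep_block.
have bb (M : 'M[F]_(k + 1)) v w : rep_vertex v *m M *m rep_vertex w =
   block_mx (if (v == ord0) && (w == ord0) then ulsubmx M else 0)
            (if (v == ord0) && (w != ord0) then ursubmx M else 0)
            (if (v != ord0) && (w == ord0) then dlsubmx M else 0)
            (if (v != ord0) && (w != ord0) then drsubmx M else 0).
  rewrite -{1}[M]submxK /rep_vertex.
  by case: ifP => _; case: ifP => _; rewrite /= !mulmx_block
    ?(mulmx0, mul0mx, mulmx1, mul1mx, addr0, add0r).
rewrite bb /act /rep_arrow; case: z => -[] /=; congr block_mx => //.
- by rewrite col_row_mx opprK.
- by rewrite row_col_mx.
- by rewrite row_col_mx.
- by rewrite col_row_mx.
Qed.

Lemma act_rep (phi : autRc F) q : rep (act phi q) =1 rep q \o phi.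
Proof.
apply: pathalg_morph_uniq.
- exact: rep_linear.
- by move=> c u v /=; rewrite (autRc_linear (autRcP phi)) (rep_linear q).
- exact: rep_monoid.
- split=> [|u v] /=.
    by rewrite (autRc_monoid (autRcP phi)) (rep_monoid q).
  by rewrite (autRc_monoid (autRcP phi)).2 (rep_monoid q).2.
- move=> v /=; rewrite autRc_pi; rewrite !rep_pi //.
- by move=> z /=; rewrite rep_arr rep_act_arrow.
Qed.

Lemma act_repE (phi : autRc F) q u : rep (act phi q) u = rep q (phi u).
Proof. exact: act_rep. Qed.

Lemma rep_inj q q' : rep q =1 rep q' -> q = q'.
Proof.
case: q q' => [[[A B] i] j] [[[A' B'] i'] j'] e.
have E z := e (arr F z).
have := E (inl Qa); have := E (inr Qa); have := E (inl Qx); have := E (inr Qx).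
have := E (inl Qy); have := E (inr Qy); rewrite !rep_arr /=.
move=> /eq_block_mx[_ i1 _ _] /eq_block_mx[_ _ j1 _] /eq_block_mx[_ _ j0 _].
move=> /eq_block_mx[_ /oppr_inj i0 _ _] /eq_block_mx[-> _ _ _] /eq_block_mx[-> _ _ _].
congr (_, _, _, _); apply/matrixP => a b.
  case: (splitP (b : 'I_(1 + 1))) => b'; rewrite (ord1 b') => eb.
    have -> : b = 0 by exact: val_inj.
    by have /matrixP/(_ a 0) := i0; rewrite !mxE.
  have -> : b = 1 by exact: val_inj.
  by have /matrixP/(_ a 0) := i1; rewrite !mxE.
case: (splitP (a : 'I_(1 + 1))) => b'; rewrite (ord1 b') => eb.
  have -> : a = 0 by exact: val_inj.
  by have /matrixP/(_ 0 b) := j0; rewrite !mxE.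
have -> : a = 1 by exact: val_inj.
by have /matrixP/(_ 0 b) := j1; rewrite !mxE.
Qed.

Lemma mul_col_row (i : 'M[F]_(k, 2)) (j : 'M[F]_(2, k)) :
  i *m j = col 0 i *m row 0 j + col 1 i *m row 1 j.
Proof.
apply/matrixP => a b; rewrite !mxE !big_ord_recl big_ord0 addr0 !big_ord0 !addr0 !mxE.
by congr (_ + i _ _ * j _ _); exact: val_inj.
Qed.

Lemma rep_c q : ulsubmx (rep q c_elt) = moment q.
Proof.
have lq (u v : CQ F) : rep q (u + v) = rep q u + rep q v.
  by have := rep_linear q 1 u v; rewrite !scale1r.
have ln (u : CQ F) : rep q (- u) = - rep q u.
  by rewrite -scaleN1r (linear_scal (rep_linear q)) scaleN1r.
rewrite /c_elt /comm !(lq, ln) !(rep_monoid q).2 !rep_arr.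
case: q {lq ln} => [[[A B] i] j] /=.
rewrite -!mulmxE !mulmx_block !(mulmx0, mul0mx, addr0, add0r).
rewrite !(opp_block_mx, add_block_mx) !block_mxKul !(oppr0, addr0, add0r).
by rewrite mulNmx [i *m j]mul_col_row opprD addrA.
Qed.

Lemma act_moment (phi : autRc F) q : moment (act phi q) = moment q.
Proof. by rewrite -!rep_c act_rep /= (autRc_fixc (autRcP phi)). Qed.

Definition gl_mx (g : 'M[F]_k) : 'M[F]_(k + 1) := block_mx g 0 0 1%:M.

Lemma rep_gl g q u : g \in unitmx ->
  rep (gl_act g q) u = gl_mx g *m rep q u *m gl_mx (invmx g).
Proof.
move=> gU; pose f u := gl_mx g *m rep q u *m gl_mx (invmx g).
have gg : gl_mx g *m gl_mx (invmx g) = 1%:M.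
  rewrite mulmx_block !(mulmx0, mul0mx, addr0, add0r) mulmxV // mul1mx.
  by rewrite -scalar_mx_block.
have gg' := mulmx1C gg.
rewrite -/(f u); move: u; apply: pathalg_morph_uniq.
- exact: rep_linear.
- by move=> c u v; rewrite /f (rep_linear q) mulmxDr mulmxDl -scalemxAr -scalemxAl.
- exact: rep_monoid.
- split=> [|u v]; first by rewrite /f (rep_monoid q) [X in X *m _]mulmx1 gg.
  rewrite /f (rep_monoid q).2 -mulmxE -!mulmxA; congr (_ *m (_ *m _)).
  by rewrite [RHS]mulmxA gg' mul1mx.
- move=> v; rewrite /f !rep_pi /rep_vertex.
  by case: ifP => _; rewrite !mulmx_block
    ?(mulmx0, mul0mx, mulmx1, mul1mx, addr0, add0r, mulmxV gU).
move=> z; rewrite /f !rep_arr; case: q {f} => [[[A B] i] j].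
case: z => -[] /=; rewrite !mulmx_block
    ?(mulmx0, mul0mx, mulmx1, mul1mx, addr0, add0r) ?(mulmxN, mulNmx) //;
  congr block_mx; try by rewrite ?colE ?rowE ?mulmxA.
Qed.

Lemma act_gl (phi : autRc F) g q : g \in unitmx ->
  act phi (gl_act g q) = gl_act g (act phi q).
Proof.
move=> gU; apply: rep_inj => u.
by rewrite act_repE !rep_gl // act_repE.
Qed.

Lemma act1 q : act 1%g q = q.
Proof. by apply: rep_inj => u; rewrite act_repE. Qed.

(* rho |-> rho \o phi is a right action. *)
Lemma actM (phi psi : autRc F) q : act (phi * psi)%g q = act psi (act phi q).
Proof. by apply: rep_inj => u; rewrite !act_repE. Qed.

Lemma gl_act1 q : gl_act 1%:M q = q.
Proof.
case: q => [[[A B] i] j]; rewrite /= invmx1 !mulmx1.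
by rewrite !mul1mx.
Qed.

Lemma gl_actM g h q : g \in unitmx -> h \in unitmx ->
  gl_act g (gl_act h q) = gl_act (g *m h) q.
Proof.
move=> gU hU; case: q => [[[A B] i] j] /=.
have -> : invmx (g *m h) = invmx h *m invmx g.
  apply: (can_inj (mulKmx (_ : g *m h \in unitmx))); first by rewrite unitmx_mul gU.
  by rewrite mulmxV ?unitmx_mul ?gU // mulmxA mulmxK // mulmxV.
by rewrite !mulmxA.
Qed.

Context (tau : F).

Definition Nsol := {q : quad | moment q == tau%:M}.

Definition gl_equiv (p q : Nsol) : bool :=
  `[< exists2 g, g \in unitmx & val q = gl_act g (val p) >].

Lemma gl_equiv_refl : reflexive gl_equiv.
Proof. by move=> p; apply/asboolP; exists 1%:M; rewrite ?unitmx1 ?gl_act1. Qed.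

Lemma gl_equiv_sym : symmetric gl_equiv.
Proof.
suff S p q : gl_equiv p q -> gl_equiv q p.
  by move=> p q; apply/idP/idP; exact: S.
move=> /asboolP[g gU e]; apply/asboolP; exists (invmx g); first by rewrite unitmx_inv.
by rewrite e gl_actM ?unitmx_inv // mulVmx // gl_act1.
Qed.

Lemma gl_equiv_trans : transitive gl_equiv.
Proof.
move=> q p r /asboolP[g gU e] /asboolP[h hU e']; apply/asboolP.
by exists (h *m g); rewrite ?unitmx_mul ?hU // e' e gl_actM.
Qed.

Canonical gl_equiv_rel :=
  EquivRel gl_equiv gl_equiv_refl gl_equiv_sym gl_equiv_trans.

Definition Nvar := {eq_quot gl_equiv}%qT.
HB.instance Definition _ := Choice.on Nvar.
HB.instance Definition _ := Quotient.on Nvar.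

Lemma act_sol_subproof (phi : autRc F) (q : Nsol) :
  moment (act phi (val q)) == tau%:M.
Proof. by rewrite act_moment; exact: (valP q). Qed.

Definition act_sol (phi : autRc F) (q : Nsol) : Nsol :=
  exist _ (act phi (val q)) (act_sol_subproof phi q).

Definition Nact (phi : autRc F) (p : Nvar) : Nvar :=
  (\pi_Nvar (act_sol phi (repr p)))%qT.

(* Nact does not depend on the choice of representative. *)
Lemma Nact_pi (phi : autRc F) (q : Nsol) :
  Nact phi (\pi_Nvar q)%qT = (\pi_Nvar (act_sol phi q))%qT.
Proof.
apply/eqmodP => /=.
have /eqmodP/asboolP[g gU e] : (repr (\pi_Nvar q) = q %[mod Nvar])%qT by rewrite reprK.
by apply/asboolP; exists g => //=; rewrite e act_gl.
Qed.

End Variety.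

(* One orbit, in particular X is not empty (as in atrans). *)
Definition acts_transitively (G X : Type) (H : set G) (to : G -> X -> X) : Prop :=
  inhabited X /\ forall x y : X, exists2 g, H g & to g x = y.

(* Main.v *)
From HB Require Import structures.
Require Import Defs.
From mathcomp Require Import all_boot all_order all_algebra all_field ring.
From mathcomp Require Import boolp classical_sets.
From mathcomp Require Import reals.
From mathcomp.real_closed Require Import complex.
From mathcomp.multinomials Require Import monalg.

Set Implicit Arguments.
Unset Strict Implicit.
Unset Printing Implicit Defensive.

Import GRing.Theory.
Local Open Scope ring_scope.

(** A point is a tuple (A, B, i1, i2, j1, j2) with [A, B] = tau + i1 j1 + i2 j2.
    Up to simultaneous conjugation, tame automorphisms realize these moves: the
    rotation (A, B) -> (B, - A), the exchange of the indices 1 and 2, the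
    translations B -> B + t A^n, and the shears, which keep A, i1, j2 and send i2
    to i2 - t A^n i1 and j1 to j1 + t j2 A^n.  A shear is the Hamiltonian flow of
    the cyclic word a^n x y.  Conjugating a shear by the rotation gives the
    feedback move [orb_feedback], which replaces A by A + t i1 j2 and keeps B, i1
    and j2.

    Suppose first that A has k distinct eigenvalues d.  Diagonalize A.  The
    diagonal of the moment equation shows that the rows of (i1, i2) do not
    vanish, so that after adding a multiple of i2 to i1 no entry of i1 vanishes,
    and a diagonal conjugation makes them all 1.  A combination of shears found by
    interpolation then kills i2.  Now the moment equation gives j1 and the
    off-diagonal part of B.  As i2 = 0, the shears with the indices 1 and 2
    exchanged affect j2 alone and move it to any prescribed row w; translations
    clear the diagonal of B.  Hence the orbit contains [normal_form d w] for every
    w ([to_normal_form]).  Since w is arbitrary, a feedback move gives A any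
    characteristic polynomial ([pole_placement]), in particular one with the roots
    0, ..., k - 1; so all these points lie in one orbit.

    It remains to find in each orbit a point where A has k distinct eigenvalues
    ([separable_in_orbit]).  Take a point of the orbit with as many distinct
    eigenvalues as possible.  Let D be the characteristic polynomial of A, N the
    adjugate of X - A, and T_ab = j_a N i_b.  The feedback move replaces D by
    D - t T_21.  For almost all t this polynomial has more distinct roots than D,
    unless T_21 vanishes at each multiple root of D to the order to which D does
    ([pencil_droots]).  So at a root of D of order n > 1 the polynomial T_21, and
    by symmetry T_12 and T_11 - T_22, vanish to order n.  The images of the point
    under almost all feedback moves are maximal too, so T_12 vanishes to order n
    there as well.  The coefficient of t in this condition involves B; adding the
    same condition with 1 and 2 exchanged leaves B only in a commutator with N,
    which the moment equation evaluates ([commutator_curvature]).  The outcome is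
    that tau^2 tr N^2 vanishes to order 2 n.  But tr N^2 = D'^2 - D D''
    ([tr_adj_sqr]) vanishes to order 2 n - 2 only. *)

(** * Endomorphisms of path algebras *)

Section PathEndomorphisms.
Context (Q : quiver) (F : fieldType).
Local Notation A := (pathalg Q F).
Local Notation pi_ := (@pi_ Q F).
Local Notation arr := (@arr Q F).
Implicit Types (m : arrow Q -> A).

Definition pathext m : A -> A :=
  linext (fun p => (pi_ (ptgt p) : A) * foldr (fun z (u : A) => m z * u) 1 (pword p)).

(** The image of an arrow must start and end where the arrow does: this makes the
    images of two words multiply to zero as soon as the words do not compose. *)
Definition compatible m :=
  forall z, (pi_ (tgt z) : A) * m z = m z /\ m z * (pi_ (src z) : A) = m z.

Lemma pathext_linear m : linear (pathext m).
Proof. exact: linext_is_linear. Qed.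

Lemma pathext_basis m p :
  pathext m (pbasis F p) =
    (pi_ (ptgt p) : A) * foldr (fun z (u : A) => m z * u) 1 (pword p).
Proof. by rewrite pbasisE; exact: linextU. Qed.

Lemma pathext_pi m v : pathext m (pi_ v) = pi_ v.
Proof. by rewrite pathext_basis /= mulr1. Qed.

Lemma pathext_arr m z : compatible m -> pathext m (arr z) = m z.
Proof. by move=> mP; rewrite pathext_basis /= mulr1 (mP z).1. Qed.

Lemma pathext_src m p : compatible m ->
  pathext m (pbasis F p) * (pi_ (psrc p) : A) = pathext m (pbasis F p).
Proof.
move=> mP; rewrite pathext_basis /psrc; case: p => -[t s] /= sP.
rewrite /ptgt /pword /=; elim: s t sP => [|z s IH] t sP.
  by rewrite /= mulr1 Defs.pi_mul eqxx.
have /andP[/eqP tz sP'] : (tgt z == t) && composable (src z) s by [].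
by subst t; rewrite /= -{1 2}(mP z).2 -!mulrA [X in _ * (_ * X)]mulrA (IH _ sP').
Qed.

Lemma pathext_monoid m : compatible m -> GRing.monoid_morphism (pathext m).
Proof.
move=> mP; split.
  pose f : {linear A -> A} :=
    HB.pack (pathext m) (GRing.isLinear.Build _ _ _ _ _ (pathext_linear m)).
  rewrite -(sum_pi Q F) -[LHS]/(f _) linear_sum.
  by apply: eq_bigr => v _; exact: pathext_pi.
have M1 p q : pathext m (pmul1 F p q) =
    pathext m (pbasis F p) * pathext m (pbasis F q).
  rewrite /pmul1; have [E|N] := eqVneq (psrc p) (ptgt q); last first.
    rewrite (pcatN N) -(pathext_src p mP) [pathext m (pbasis F q)]pathext_basis.
    by rewrite -mulrA [X in _ = _ * X]mulrA Defs.pi_mul (negbTE N) mul0r mulr0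
               /pathext linear0.
  have [r -> [tr wr _]] := pcatP E.
  rewrite -(pathext_src p mP) E [pathext m (pbasis F q)]pathext_basis.
  rewrite -mulrA [X in _ = _ * X]mulrA Defs.pi_mul eqxx mulrA -E (pathext_src p mP).
  rewrite !pathext_basis tr wr -mulrA; congr (_ * _).
  by elim: (pword p) => [|z s IH] /=; rewrite ?mul1r // IH mulrA.
move=> u w.
refine (@linext_uniq _ _ _ (fun u : A => pathext m (u * w))
  (fun u => pathext m u * pathext m w) _ _ _ u).
- by move=> c x y; rewrite mulrDl -pathalgZl pathext_linear.
- by move=> c x y; rewrite pathext_linear mulrDl -pathalgZl.
move=> p /=.
refine (@linext_uniq _ _ _ (fun w : A => pathext m ((<< p >> : A) * w))
  (fun w => pathext m << p >> * pathext m w) _ _ _ w).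
- by move=> c x y; rewrite mulrDr -pathalgZr pathext_linear.
- by move=> c x y; rewrite pathext_linear mulrDr -pathalgZr.
by move=> q /=; rewrite -!pbasisE -M1; congr (pathext m _); exact: pmulE.
Qed.

(** Idempotents and arrows generate the path algebra. *)
Lemma path_endo_uniq (f g : A -> A) :
  linear f -> linear g -> GRing.monoid_morphism f -> GRing.monoid_morphism g ->
  (forall v, f (pi_ v) = g (pi_ v)) -> (forall z, f (arr z) = g (arr z)) ->
  f =1 g.
Proof.
move=> lf lg [f1 fM] [g1 gM] fgpi fgarr; apply: linext_uniq => // p.
rewrite -pbasisE pbasis_prod fM gM fgpi; congr (_ * _).
by elim: (pword p) => [|z s IH] /=; rewrite ?f1 ?g1 // fM gM fgarr IH.
Qed.

(** By uniqueness it suffices to look at the arrows.  This is how all the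
    automorphisms below are shown to be bijective. *)
Lemma pathextK m m' : compatible m -> compatible m' ->
  (forall z, pathext m (m' z) = arr z) -> cancel (pathext m') (pathext m).
Proof.
move=> mP mP' mm'.
have [m1 mM] := pathext_monoid mP; have [m'1 m'M] := pathext_monoid mP'.
apply: (@path_endo_uniq (pathext m \o pathext m') id) => //=.
- by move=> c u v /=; rewrite !pathext_linear.
- by split=> [|u v] /=; rewrite ?m'1 ?m1 // m'M mM.
- by move=> v /=; rewrite !pathext_pi.
- by move=> z /=; rewrite pathext_arr.
Qed.

End PathEndomorphisms.

Section Automorphisms.
Context (F : fieldType).
Local Notation A := (CQ F).

Lemma pathext_autRc (m m' : arrow (Defs.double Qfig) -> A) :
  compatible m -> compatible m' ->
  (forall z, pathext m (m' z) = arr F z) -> (forall z, pathext m' (m z) = arr F z) ->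
  pathext m c_elt = c_elt -> is_autRc (pathext m).
Proof.
move=> mP mP' mm' m'm mc; split=> //.
- exact: pathext_linear.
- exact: pathext_monoid.
- by exists (pathext m'); exact: pathextK.
- move=> s t; rewrite pathext_linear.
  have -> : pathext m (t *: g_pi2) = t *: g_pi2.
    by rewrite (linear_scal (pathext_linear m)) pathext_pi.
  by rewrite pathext_pi.
Qed.

Lemma pathextD (m : arrow (Defs.double Qfig) -> A) u v :
  pathext m (u + v) = pathext m u + pathext m v.
Proof. by have := pathext_linear m 1 u v; rewrite !scale1r. Qed.

Lemma pathextZ (m : arrow (Defs.double Qfig) -> A) c u :
  pathext m (c *: u) = c *: pathext m u.
Proof. exact: (linear_scal (pathext_linear m)). Qed.

Lemma pathextN (m : arrow (Defs.double Qfig) -> A) u :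
  pathext m (- u) = - pathext m u.
Proof. by rewrite -scaleN1r pathextZ scaleN1r. Qed.

Lemma commDr (p q r : A) : Defs.comm p (q + r) = Defs.comm p q + Defs.comm p r.
Proof. by rewrite /Defs.comm mulrDl mulrDr opprD addrACA. Qed.

Definition tri_images (u v w : A) (z : arrow (Defs.double Qfig)) : A :=
  match z with
  | inr Qa => g_as + u
  | inr Qx => g_xs + v
  | inr Qy => g_ys + w
  | _ => arr F z
  end.

Lemma arr_typed (z : arrow (Defs.double Qfig)) :
  (pi_ F (tgt z) : A) * (arr F z : A) = arr F z /\
  (arr F z : A) * (pi_ F (src z) : A) = arr F z.
Proof. by split; [exact: pi_arr | exact: arr_pi]. Qed.

Lemma addr3ACA (V : zmodType) (p p1 q q1 r r1 : V) :
  (p + p1) + (q + q1) + (r + r1) = (p + q + r) + (p1 + q1 + r1).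
Proof. by rewrite (addrACA p) [RHS]addrACA. Qed.

(** The inverse is obtained by changing the signs of u, v and w; this works because
    u, v and w are combinations of words in a, x and y, so that the automorphism does not move them.
    The last hypothesis expresses this without naming the subalgebra generated by a,
    x and y.  The condition on commutators is the invariance of c. *)
Lemma triangular_exists (u v w : A) :
  [/\ g_pi1 * u = u, g_pi2 * v = v & g_pi1 * w = w] ->
  [/\ u * g_pi1 = u, v * g_pi1 = v & w * g_pi2 = w] ->
  Defs.comm g_a u + Defs.comm g_x v + Defs.comm g_y w = 0 ->
  (forall f : A -> A, linear f -> GRing.monoid_morphism f -> f g_pi1 = g_pi1 ->
     f g_a = g_a -> f g_x = g_x -> f g_y = g_y -> [/\ f u = u, f v = v & f w = w]) ->
  exists2 phi : autRc F, strictly_triangular phi &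
    [/\ phi g_as = g_as + u, phi g_xs = g_xs + v & phi g_ys = g_ys + w].
Proof.
move=> [ul vl wl] [ur vr wr] c0 fixed.
have compat (s : F) : compatible (tri_images (s *: u) (s *: v) (s *: w)).
  move=> z; have [zl zr] := arr_typed z.
  case: z zl zr => -[] //= zl zr; rewrite mulrDl mulrDr -pathalgZl -pathalgZr zl zr.
  - by split; congr (_ + _ *: _); [exact: ul|exact: ur].
  - by split; congr (_ + _ *: _); [exact: vl|exact: vr].
  - by split; congr (_ + _ *: _); [exact: wl|exact: wr].
have val (s : F) z := pathext_arr z (compat s).
have fix_uvw (s : F) := fixed _ (pathext_linear _) (pathext_monoid (compat s))
  (pathext_pi _ _) (val s (inl Qa)) (val s (inl Qx)) (val s (inl Qy)).
have inv (s s' : F) : s' = - s -> forall z,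
    pathext (tri_images (s *: u) (s *: v) (s *: w))
      (tri_images (s' *: u) (s' *: v) (s' *: w) z) = arr F z.
  move=> -> z; have [fu fv fw] := fix_uvw s.
  by case: z => -[] /=; rewrite ?pathextD ?pathextZ val //= ?fu ?fv ?fw -addrA
    -scalerDl subrr scale0r addr0.
have autP : is_autRc (pathext (tri_images (1 *: u) (1 *: v) (1 *: w))).
  apply: (pathext_autRc (compat 1) (compat (-1)) (inv 1 (-1) _) (inv (-1) 1 _)) => //.
    by rewrite opprK.
  have [m1 mM] := pathext_monoid (compat 1).
  have ext_comm p q : pathext (tri_images (1 *: u) (1 *: v) (1 *: w)) (Defs.comm p q)
      = Defs.comm (pathext (tri_images (1 *: u) (1 *: v) (1 *: w)) p)
                  (pathext (tri_images (1 *: u) (1 *: v) (1 *: w)) q).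
    by rewrite /Defs.comm pathextD pathextN !mM.
  rewrite /c_elt 2!pathextD !ext_comm !val /= !scale1r !commDr.
  apply: (etrans (addr3ACA _ _ _ _ _ _)); by rewrite c0 addr0.
exists (AutRc autP); first by split; rewrite /= val.
by split; rewrite /= val /= scale1r.
Qed.
End Automorphisms.

(** * Some tame automorphisms *)

Section Generators.
Context (F : fieldType).
Local Notation A := (CQ F).

Lemma pi1_a : g_pi1 * g_a = g_a :> A.
Proof. exact: (arr_typed F (inl Qa)).1. Qed.
Lemma a_pi1 : g_a * g_pi1 = g_a :> A.
Proof. exact: (arr_typed F (inl Qa)).2. Qed.
Lemma pi1_x : g_pi1 * g_x = g_x :> A.
Proof. exact: (arr_typed F (inl Qx)).1. Qed.
Lemma x_pi2 : g_x * g_pi2 = g_x :> A.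
Proof. exact: (arr_typed F (inl Qx)).2. Qed.
Lemma pi2_y : g_pi2 * g_y = g_y :> A.
Proof. exact: (arr_typed F (inl Qy)).1. Qed.
Lemma y_pi1 : g_y * g_pi1 = g_y :> A.
Proof. exact: (arr_typed F (inl Qy)).2. Qed.
Lemma pi1K : g_pi1 * g_pi1 = g_pi1 :> A.
Proof. by rewrite [LHS]Defs.pi_mul eqxx. Qed.

Lemma commZr (t : F) (p q : A) : Defs.comm p (t *: q) = t *: Defs.comm p q.
Proof. by rewrite /Defs.comm scalerBr (pathalgZr t p q) (pathalgZl t q p). Qed.

Lemma commC (p q : A) : Defs.comm p q = - Defs.comm q p.
Proof. by rewrite /Defs.comm opprB. Qed.

Lemma pi1_aX n : g_pi1 * g_a ^+ n = g_a ^+ n * g_pi1 :> A.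
Proof.
elim: n => [|n IH]; first by rewrite !expr0 mul1r mulr1.
by rewrite {1}exprSr mulrA IH -mulrA pi1_a -a_pi1 [in RHS]exprSr -!mulrA pi1K.
Qed.

Lemma a_translation (t : F) n :
  exists2 phi : autRc F, strictly_triangular phi &
    [/\ phi g_as = g_as + t *: (g_pi1 * g_a ^+ n), phi g_xs = g_xs &
        phi g_ys = g_ys].
Proof.
case: (@triangular_exists F (t *: (g_pi1 * g_a ^+ n)) 0 0).
- by split; rewrite ?mulr0 // -scalerAr mulrA pi1K.
- by split; rewrite ?mul0r // -scalerAl -mulrA -pi1_aX mulrA pi1K.
- rewrite /Defs.comm !(mulr0, mul0r) !subr0 !addr0 -scalerAr -scalerAl mulrA a_pi1.
  by rewrite -mulrA -exprSr exprS mulrA pi1_a subrr.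
- move=> f lf [f1 fM] fpi fa _ _.
  have f0 : f 0 = 0 by have := linear_scal lf 0 0; rewrite !scale0r.
  split=> //; rewrite (linear_scal lf) fM fpi; congr (_ *: (_ * _)).
  by elim: n => [|n IH]; rewrite ?expr0 // !exprS fM fa IH.
by move=> phi phiT []; rewrite !addr0; exists phi.
Qed.

(** The cyclic derivative with respect to a of the word a^n x y, that is, the sum of
    the a^l x y a^(n - 1 - l) for l < n. *)
Fixpoint hook n : A :=
  if n is n'.+1 then g_a * hook n' + g_x * (g_y * g_a ^+ n') else 0.

(** The sum telescopes. *)
Lemma comm_hook n :
  g_a * hook n - hook n * g_a =
    g_a ^+ n * (g_x * g_y) - g_x * (g_y * g_a ^+ n).
Proof.
elim: n => [|n IH]; first by rewrite /= mulr0 mul0r !expr0 mulr1 mul1r !subrr.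
rewrite /= mulrDr mulrDl opprD addrACA -!mulrA -mulrBr IH mulrBr.
by rewrite -exprSr addrA subrK exprS -mulrA.
Qed.

(** The flow of the cyclic word a^n x y: each reversed arrow moves along the cyclic
    derivative with respect to the arrow.  It preserves c because the commutators of
    the arrows with these derivatives add up to zero. *)
Lemma hook_shear (t : F) n :
  exists2 phi : autRc F, strictly_triangular phi &
    [/\ phi g_as = g_as + t *: hook n, phi g_xs = g_xs + t *: (g_y * g_a ^+ n) &
        phi g_ys = g_ys + t *: (g_a ^+ n * g_x)].
Proof.
apply: triangular_exists.
- split; rewrite -scalerAr; congr (_ *: _).
  + by elim: n => [|n IH]; rewrite ?mulr0 //= mulrDr !mulrA pi1_a pi1_x.
  + by rewrite mulrA pi2_y.
  + by rewrite mulrA pi1_aX -mulrA pi1_x.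
- split; rewrite -scalerAl; congr (_ *: _).
  + elim: n => [|n IH]; rewrite ?mul0r //= mulrDl -!mulrA IH -pi1_aX.
    by rewrite (mulrA g_y) y_pi1.
  + by rewrite -mulrA -pi1_aX mulrA y_pi1.
  + by rewrite -mulrA x_pi2.
- rewrite !commZr -!scalerDr [X in X + _ + _]comm_hook /Defs.comm -!mulrA.
  by rewrite 2!subrKA subrr scaler0.
- move=> f lf [f1 fM] fpi fa fx fy.
  have f0 : f 0 = 0 by have := linear_scal lf 0 0; rewrite !scale0r.
  have fD p q : f (p + q) = f p + f q by have := lf 1 p q; rewrite !scale1r.
  have fX m : f (g_a ^+ m) = g_a ^+ m.
    by elim: m => [|m IH]; rewrite ?expr0 // !exprS fM fa IH.
  split; rewrite (linear_scal lf t); congr (_ *: _).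
  + elim: n => [|n IH]; first exact: f0.
    by rewrite /= fD (fM g_a) (fM g_x) (fM g_y) fX fa fx fy IH.
  + by rewrite (fM g_y) fX fy.
  + by rewrite (fM (g_a ^+ n)) fX fx.
Qed.

(** The value s = 1 gives a rotation of the plane spanned by a and its reverse, the
    value s = - 1 the inverse rotation. *)
Definition rotation_images (s : F) (z : arrow (Defs.double Qfig)) : A :=
  match z with
  | inl Qa => s *: g_as
  | inr Qa => (- s) *: g_a
  | _ => arr F z
  end.

(** The transposition matrix of GL(2), which exchanges - x with the reverse of y. *)
Definition swap_images (z : arrow (Defs.double Qfig)) : A :=
  match z with
  | inl Qx => - g_ys
  | inr Qy => - g_x
  | inr Qx => g_y
  | inl Qy => g_xs
  | _ => arr F z
  end.

Lemma rotation_compatible s : compatible (rotation_images s).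
Proof.
move=> z; have [zl zr] := arr_typed F z.
case: z zl zr => -[] //= _ _; rewrite -pathalgZl -pathalgZr; split; congr (_ *: _).
- exact: (arr_typed F (inr Qa)).1.
- exact: (arr_typed F (inr Qa)).2.
- exact: pi1_a.
- exact: a_pi1.
Qed.

Lemma swap_compatible : compatible swap_images.
Proof.
move=> z; have [zl zr] := arr_typed F z.
case: z zl zr => -[] //= _ _; rewrite ?mulrN ?mulNr; split; try congr (- _).
- exact: (arr_typed F (inr Qy)).1.
- exact: (arr_typed F (inr Qy)).2.
- exact: (arr_typed F (inr Qx)).1.
- exact: (arr_typed F (inr Qx)).2.
- exact: pi2_y.
- exact: y_pi1.
- exact: pi1_x.
- exact: x_pi2.
Qed.

Lemma pathext_comm m (p q : A) : compatible m ->
  pathext m (Defs.comm p q) = Defs.comm (pathext m p) (pathext m q).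
Proof.
by move=> /pathext_monoid[_ mM]; rewrite /Defs.comm pathextD pathextN !mM.
Qed.

Lemma rotation_autRc s : s * s = 1 -> is_autRc (pathext (rotation_images s)).
Proof.
move=> ss; have P := rotation_compatible; have val s' z := pathext_arr z (P s').
apply: (@pathext_autRc _ _ (rotation_images (- s))) => //.
- case=> -[] /=; rewrite ?pathextZ ?val //= scalerA.
  + by rewrite mulrNN ss scale1r.
  + by rewrite opprK ss scale1r.
- case=> -[] /=; rewrite ?pathextZ ?val //= scalerA.
  + by rewrite opprK ss scale1r.
  + by rewrite mulrNN ss scale1r.
have e : Defs.comm (s *: g_as) ((- s) *: g_a) = Defs.comm g_a g_as :> A.
  by rewrite commZr commC commZr scalerN scaleNr opprK scalerA ss scale1r.
rewrite /c_elt 2!pathextD 3?pathext_comm; try exact: P.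
by rewrite !val /= e.
Qed.

Lemma swap_autRc : is_autRc (pathext swap_images).
Proof.
have P := swap_compatible; have val z := pathext_arr z P.
apply: (@pathext_autRc _ _ swap_images) => //.
- by case=> -[] /=; rewrite ?pathextN ?val //= opprK.
- by case=> -[] /=; rewrite ?pathextN ?val //= opprK.
have eyx : Defs.comm g_xs (- g_x) = Defs.comm g_x g_xs :> A.
  by rewrite /Defs.comm mulNr mulrN opprK addrC.
have exy : Defs.comm (- g_ys) g_y = Defs.comm g_y g_ys :> A.
  by rewrite /Defs.comm mulNr mulrN opprK addrC.
rewrite /c_elt 2!pathextD 3?pathext_comm; try exact: P.
rewrite !val /= exy eyx; exact: addrAC.
Qed.

Lemma TAut_triangular (phi : autRc F) : strictly_triangular phi -> TAut phi.
Proof. by move=> phiT H [_]; apply; left. Qed.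

Lemma TAut_affine (phi : autRc F) : Affc phi -> TAut phi.
Proof. by move=> phiA H [_]; apply; right. Qed.

Lemma TAut1 : @TAut F 1%g.
Proof. by move=> H [[]]; rewrite inE. Qed.

Lemma TAutM (phi psi : autRc F) : TAut phi -> TAut psi -> TAut (phi * psi)%g.
Proof.
move=> P1 P2 H HP; have [gH _] := HP.
have := group_closedM gH; move=> /(_ phi psi); rewrite !inE.
by apply; [exact: P1 | exact: P2].
Qed.

Lemma TAutV (phi : autRc F) : TAut phi -> TAut (phi^-1)%g.
Proof.
move=> P1 H HP; have [gH _] := HP.
have := group_closedV gH; move=> /(_ phi); rewrite !inE.
by apply; exact: P1.
Qed.

Definition rotation : autRc F := AutRc (rotation_autRc (mulr1 (1 : F))).
Definition swap : autRc F := AutRc swap_autRc.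

Definition mx2 (p q r s : F) : 'M[F]_2 :=
  \matrix_(i, j) if i == 0 then if j == 0 then p else q
                 else if j == 0 then r else s.

Lemma det_mx2 p q r s : \det (mx2 p q r s) = p * s - q * r.
Proof.
rewrite (expand_det_row _ 0) !big_ord_recl big_ord0 /cofactor !det_mx11 !mxE /=.
by rewrite expr0 mul1r expr1 mulN1r mulrN addr0.
Qed.

Lemma TAut_rotation : TAut rotation.
Proof.
have P := rotation_compatible 1; have val z := pathext_arr z P.
apply: TAut_affine; exists (mx2 0 1 (-1) 0), 0, 1%:M; split.
- by rewrite det_mx2 mulrN1 opprK mulr0 add0r.
- exact: unitmx1.
have e (z : arrow (Defs.double Qfig)) : rotation (arr F z) = rotation_images 1 z := val z.
split; rewrite ?invmx1 ?raddfN ?[rotation _]e !mxE /= ?(scale0r, scale1r, addr0, add0r) //.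
by split; rewrite ?oppr0 ?add0r ?val.
Qed.

Lemma TAut_swap : TAut swap.
Proof.
have val z := pathext_arr z swap_compatible.
have invT : invmx (mx2 0 1 1 0) = mx2 0 1 1 0.
  have TT : mx2 0 1 1 0 *m mx2 0 1 1 0 = 1%:M.
    apply/matrixP => i j; rewrite !mxE !big_ord_recl big_ord0 !mxE /=.
    by case: i j => [[|[|//]] ?] [[|[|//]] ?] /=;
      rewrite ?(mul0r, mulr0, mul1r, addr0, add0r).
  have [U _] := mulmx1_unit TT.
  by apply: (can_inj (mulKmx U)); rewrite mulmxV.
have e (z : arrow (Defs.double Qfig)) : swap (arr F z) = swap_images z := val z.
apply: TAut_affine; exists 1%:M, 0, (mx2 0 1 1 0); split.
- exact: det1.
- by rewrite unitmxE det_mx2 mul0r mul1r sub0r unitrN1.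
rewrite /affine_by invT.
split; rewrite ?raddfN ?[swap _]e !mxE /= ?(scale0r, scale1r, addr0, add0r) //.
by split; rewrite ?oppr0 ?add0r ?val /= ?opprK.
Qed.
End Generators.

(** * Tame moves on quadruples *)

Section Moves.
Context (F : fieldType) (k : nat).
Implicit Types (A B : 'M[F]_k) (q : quad F k).

Definition mkq A B (i1 i2 : 'cV[F]_k) (j1 j2 : 'rV[F]_k) : quad F k :=
  (A, B, row_mx i1 i2 : 'M_(k, 1 + 1), col_mx j1 j2 : 'M_(1 + 1, k)).

Lemma quadE q : exists A B i1 i2 j1 j2, q = mkq A B i1 i2 j1 j2.
Proof.
case: q => -[[A B] i] j; exists A, B.
exists (lsubmx (i : 'M_(k, 1 + 1))), (rsubmx (i : 'M_(k, 1 + 1))).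
exists (usubmx (j : 'M_(1 + 1, k))), (dsubmx (j : 'M_(1 + 1, k))).
by rewrite /mkq hsubmxK vsubmxK.
Qed.

Lemma moment_mkq A B i1 i2 j1 j2 :
  moment (mkq A B i1 i2 j1 j2) = A *m B - B *m A - (i1 *m j1 + i2 *m j2).
Proof. by rewrite /moment /mkq (mul_row_col i1 i2). Qed.

Lemma gl_act_mkq g A B i1 i2 j1 j2 :
  gl_act g (mkq A B i1 i2 j1 j2) =
    mkq (g *m A *m invmx g) (g *m B *m invmx g) (g *m i1) (g *m i2)
        (j1 *m invmx g) (j2 *m invmx g).
Proof. by rewrite /gl_act /mkq (mul_mx_row g i1) (mul_col_mx j1). Qed.

Section RepValues.
Context (A B : 'M[F]_k) (i1 i2 : 'cV[F]_k) (j1 j2 : 'rV[F]_k).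
Local Notation rho := (rep (mkq A B i1 i2 j1 j2)).

Lemma rep_a : rho g_a = block_mx A 0 0 0. Proof. exact: rep_arr. Qed.
Lemma rep_as : rho g_as = block_mx B 0 0 0. Proof. exact: rep_arr. Qed.
Lemma rep_x : rho g_x = block_mx 0 (- i1) 0 0.
Proof. by rewrite [LHS]rep_arr /= (col_row_mx i1). Qed.
Lemma rep_ys : rho g_ys = block_mx 0 i2 0 0.
Proof. by rewrite [LHS]rep_arr /= (col_row_mx i1). Qed.
Lemma rep_xs : rho g_xs = block_mx 0 0 j1 0.
Proof. by rewrite [LHS]rep_arr /= (row_col_mx j1). Qed.
Lemma rep_y : rho g_y = block_mx 0 0 j2 0.
Proof. by rewrite [LHS]rep_arr /= (row_col_mx j1). Qed.

Lemma repD q u v : rep q (u + v) = rep q u + rep q v.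
Proof. by have := rep_linear q 1 u v; rewrite !scale1r. Qed.

Lemma repZ q c u : rep q (c *: u) = c *: rep q u.
Proof. exact: (linear_scal (rep_linear q)). Qed.

Lemma repM q u v : rep q (u * v) = rep q u *m rep q v.
Proof. exact: (rep_monoid q).2. Qed.

Lemma repN q u : rep q (- u) = - rep q u.
Proof. by rewrite -scaleN1r repZ scaleN1r. Qed.

Lemma act_mkq (phi : autRc F) A' B' (i1' i2' : 'cV[F]_k) (j1' j2' : 'rV[F]_k) :
  [/\ rho (phi g_a) = block_mx A' 0 0 0, rho (phi g_as) = block_mx B' 0 0 0 &
   [/\ rho (phi g_x) = block_mx 0 (- i1') 0 0, rho (phi g_ys) = block_mx 0 i2' 0 0,
       rho (phi g_xs) = block_mx 0 0 j1' 0 & rho (phi g_y) = block_mx 0 0 j2' 0]] ->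
  act phi (mkq A B i1 i2 j1 j2) = mkq A' B' i1' i2' j1' j2'.
Proof.
case=> ea eas [ex eys exs ey]; rewrite /act ea eas ex eys exs ey.
by rewrite !block_mxKul !block_mxKur !block_mxKdl opprK.
Qed.

Lemma rep_pi1_aX n : rho (g_pi1 * g_a ^+ n) = block_mx (A ^+ n) 0 0 0.
Proof.
elim: n => [|n IH]; first by rewrite expr0 mulr1 [LHS]rep_pi.
rewrite exprSr mulrA repM IH rep_a mulmx_block.
by rewrite !(mulmx0, mul0mx, addr0) exprSr.
Qed.

Lemma rep_aX_x n : rho (g_a ^+ n * g_x) = block_mx 0 (- (A ^+ n *m i1)) 0 0.
Proof.
rewrite -pi1_x mulrA -pi1_aX repM rep_pi1_aX rep_x mulmx_block.
by rewrite !(mulmx0, mul0mx, addr0) mulmxN.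
Qed.

Lemma rep_y_aX n : rho (g_y * g_a ^+ n) = block_mx 0 0 (j2 *m A ^+ n) 0.
Proof.
rewrite -y_pi1 -mulrA repM rep_pi1_aX rep_y mulmx_block.
by rewrite !(mulmx0, mul0mx, addr0, add0r).
Qed.

(** The matrix of [hook n], up to the sign coming from x -> - i1. *)
Fixpoint hook_mx n : 'M[F]_k :=
  if n is n'.+1 then A *m hook_mx n' + i1 *m (j2 *m A ^+ n') else 0.

Lemma rep_hook n : rho (hook F n) = block_mx (- hook_mx n) 0 0 0.
Proof.
elim: n => [|n IH] /=; first by rewrite /rep /qrep linear0 oppr0 block_mx0.
rewrite repD (repM _ g_a) (repM _ g_x) IH rep_a rep_y_aX rep_x !mulmx_block.
by rewrite !(mulmx0, mul0mx, addr0, add0r) add_block_mx !addr0 mulmxN mulNmx opprD.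
Qed.

End RepValues.

Definition orb q q' :=
  exists phi g, [/\ TAut phi, g \in unitmx & q' = gl_act g (act phi q)].

Lemma orb_refl q : orb q q.
Proof.
by exists 1%g, 1%:M; rewrite act1 gl_act1 unitmx1; split=> //; exact: TAut1.
Qed.

Lemma orb_sym q q' : orb q q' -> orb q' q.
Proof.
case=> phi [g [phiT gU ->]]; exists (phi^-1)%g, (invmx g); split.
- exact: TAutV.
- by rewrite unitmx_inv.
by rewrite act_gl // gl_actM ?unitmx_inv // mulVmx // gl_act1 -actM mulgV act1.
Qed.

Lemma orb_trans q q' q'' : orb q q' -> orb q' q'' -> orb q q''.
Proof.
case=> phi [g [phiT gU ->]] [psi [h [psiT hU ->]]].
exists (phi * psi)%g, (h *m g); split; first exact: TAutM.
- by rewrite unitmx_mul hU.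
by rewrite act_gl // gl_actM // actM.
Qed.

Lemma orb_moment q q' (tau : F) : orb q q' -> moment q = tau%:M -> moment q' = tau%:M.
Proof.
case=> phi [g [phiT gU ->]] mq; have := act_moment phi q; rewrite mq.
case: (act phi q) => -[[A B] i] j /= e.
have -> : g *m A *m invmx g *m (g *m B *m invmx g) -
   g *m B *m invmx g *m (g *m A *m invmx g) - g *m i *m (j *m invmx g) =
   g *m (A *m B - B *m A - i *m j) *m invmx g.
  by rewrite !mulmxBr !mulmxBl !mulmxA !(mulmxKV gU).
by rewrite e mul_mx_scalar -scalemxAl mulmxV // scalemx1.
Qed.

Lemma orb_gl g q : g \in unitmx -> orb q (gl_act g q).
Proof. by move=> gU; exists 1%g, g; rewrite act1; split=> //; exact: TAut1. Qed.

Lemma orb_act (phi : autRc F) q : TAut phi -> orb q (act phi q).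
Proof. by move=> phiT; exists phi, 1%:M; rewrite gl_act1 unitmx1. Qed.

Section BasicMoves.
Context (A B : 'M[F]_k) (i1 i2 : 'cV[F]_k) (j1 j2 : 'rV[F]_k).

Lemma orb_translate (t : F) n :
  orb (mkq A B i1 i2 j1 j2) (mkq A (B + t *: A ^+ n) i1 i2 j1 j2).
Proof.
have [phi phiT [eas exs eys]] := a_translation t n.
rewrite -[X in orb _ X](@act_mkq A B i1 i2 j1 j2 phi).
  exact: orb_act (TAut_triangular phiT).
case: phiT => ea ex ey; rewrite ea eas ex exs ey eys.
split; [exact: rep_a | | split; [exact: rep_x | exact: rep_ys | exact: rep_xs |
  exact: rep_y]].
by rewrite repD repZ rep_pi1_aX rep_as scale_block_mx add_block_mx !scaler0 !addr0.
Qed.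

Lemma orb_shear (t : F) n :
  orb (mkq A B i1 i2 j1 j2)
      (mkq A (B - t *: hook_mx A i1 j2 n) i1 (i2 - t *: (A ^+ n *m i1))
           (j1 + t *: (j2 *m A ^+ n)) j2).
Proof.
have [phi phiT [eas exs eys]] := hook_shear t n.
rewrite -[X in orb _ X](@act_mkq A B i1 i2 j1 j2 phi).
  exact: orb_act (TAut_triangular phiT).
case: phiT => ea ex ey; rewrite ea eas ex exs ey eys.
split; [exact: rep_a | | split; [exact: rep_x | | | exact: rep_y]].
- rewrite repD repZ rep_hook rep_as scale_block_mx add_block_mx !scaler0 !addr0.
  by rewrite scalerN.
- rewrite repD repZ rep_aX_x rep_ys scale_block_mx add_block_mx !scaler0 !addr0.
  by rewrite scalerN.
- by rewrite repD repZ rep_y_aX rep_xs scale_block_mx add_block_mx !scaler0 !addr0.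
Qed.

Lemma orb_rotate : orb (mkq A B i1 i2 j1 j2) (mkq B (- A) i1 i2 j1 j2).
Proof.
have val z := pathext_arr z (@rotation_compatible F 1).
rewrite -[X in orb _ X](@act_mkq A B i1 i2 j1 j2 (rotation F)).
  exact: orb_act (@TAut_rotation F).
rewrite /= !val /=.
split; [ | | split; [exact: rep_x | exact: rep_ys | exact: rep_xs | exact: rep_y]].
- by rewrite repZ rep_as scale1r.
- by rewrite repZ rep_a scale_block_mx !scaler0 scaleN1r.
Qed.

Lemma orb_swap : orb (mkq A B i1 i2 j1 j2) (mkq A B i2 i1 j2 j1).
Proof.
have val z := pathext_arr z (@swap_compatible F).
rewrite -[X in orb _ X](@act_mkq A B i1 i2 j1 j2 (swap F)).
  exact: orb_act (@TAut_swap F).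
rewrite /= !val /=.
split; [exact: rep_a | exact: rep_as | split].
- by rewrite repN rep_ys opp_block_mx !oppr0.
- by rewrite repN rep_x opp_block_mx !oppr0 opprK.
- exact: rep_y.
- exact: rep_xs.
Qed.

End BasicMoves.

(** The rotation exchanges the roles of A and B, so this is the shear of the word
    a x y between two rotations; the inverse rotation is the cube of the rotation. *)
Lemma orb_feedback A B i1 i2 j1 j2 (t : F) :
  orb (mkq A B i1 i2 j1 j2)
      (mkq (A + t *: (i1 *m j2)) B i1 (i2 - t *: (B *m i1)) (j1 + t *: (j2 *m B)) j2).
Proof.
apply: orb_trans (orb_rotate _ _ _ _ _ _) _.
apply: orb_trans (orb_shear _ _ _ _ _ _ t 1) _.
apply: orb_trans (orb_rotate _ _ _ _ _ _) _.
apply: orb_trans (orb_rotate _ _ _ _ _ _) _.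
rewrite /= mulmx0 add0r expr0 mulmx1 expr1.
apply: orb_trans (orb_rotate _ _ _ _ _ _) _.
by rewrite (opprB (- A)) !opprK [_ + A]addrC; exact: orb_refl.
Qed.

End Moves.

(** * Distinct roots in a pencil of polynomials *)

Section DistinctRoots.
Context (F : numClosedFieldType).
Implicit Types (p q f g h u v : {poly F}) (x t : F).

Definition droots p : seq F := undup (sval (closed_field_poly_normal p)).

Lemma droots_uniq p : uniq (droots p).
Proof. exact: undup_uniq. Qed.

Lemma mem_droots p x : p != 0 -> (x \in droots p) = root p x.
Proof.
move=> p0; rewrite mem_undup; case: closed_field_poly_normal => r /= ->.
by rewrite rootZ ?lead_coef_eq0 // root_prod_XsubC.
Qed.

Lemma size_droots_separable p :
  separable_poly p -> size (droots p) = (size p).-1.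
Proof.
move=> sp; have p0 := separable_poly_neq0 sp.
rewrite /droots; case: closed_field_poly_normal => r /= e.
have lc0 : lead_coef p != 0 by rewrite lead_coef_eq0.
rewrite undup_id; first by rewrite e size_scale // size_prod_XsubC.
by rewrite -separable_prod_XsubC -(eqp_separable (eqp_scale _ lc0)) -e.
Qed.

Lemma size_droots_double p x : p != 0 -> root p x -> root p^`() x ->
  (size (droots p) < (size p).-1)%N.
Proof.
move=> p0 px p'x.
have : ~~ separable_poly p.
  by rewrite unlock; apply/negP => sp; move: (coprimep_root sp px); rewrite -/(root _ _) p'x.
rewrite /droots; case: closed_field_poly_normal => r /= e.
have lc0 : lead_coef p != 0 by rewrite lead_coef_eq0.
rewrite {1}e (eqp_separable (eqp_scale _ lc0)) separable_prod_XsubC => nu.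
by rewrite e size_scale // size_prod_XsubC /= ltn_size_undup.
Qed.

Lemma size_droots p : p != 0 -> (size (droots p) <= (size p).-1)%N.
Proof.
move=> p0; rewrite /droots; case: closed_field_poly_normal => r /= e.
by rewrite e size_scale ?lead_coef_eq0 // size_prod_XsubC size_undup.
Qed.

Lemma deriv_eq0_size p : p^`() = 0 -> (size p <= 1)%N.
Proof.
move=> p'0; rewrite leqNgt; apply/negP; case E: (size p) => [|[|n]] // _.
have := congr1 (fun r : {poly F} => r`_n) p'0.
rewrite coef_deriv coef0 => /eqP; rewrite Num.Theory.mulrn_eq0 /=.
have <- : (size p).-1 = n.+1 by rewrite E.
rewrite -lead_coefE lead_coef_eq0 => /eqP p0.
by rewrite p0 size_poly0 in E.
Qed.

(** Otherwise u would divide u' v, hence u', and u would be constant. *)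
Lemma wronskian_neq0 u v : coprimep u v -> v != 0 -> (size v < size u)%N ->
  u^`() * v - u * v^`() != 0.
Proof.
move=> cuv v0 suv; apply/negP; rewrite subr_eq0 => /eqP e.
have : u %| u^`() * v by rewrite e dvdp_mulIl.
rewrite Gauss_dvdpl // => d.
have u0 : u != 0 by apply: contraTneq suv => ->; rewrite size_poly0.
have u'0 : u^`() = 0.
  apply/eqP/negPn/negP => n0; have := dvdp_leq n0 d.
  by rewrite leqNgt lt_size_deriv.
have := leq_trans suv (deriv_eq0_size u'0).
by rewrite ltnS leqn0 size_poly_eq0 (negbTE v0).
Qed.

(** A double root x of u - t v satisfies u(x) = t v(x) and u'(x) = t v'(x), so it is
    a root of the Wronskian, and t = u(x) / v(x).  Thus only finitely many t are
    bad; the same formula excludes common roots with f. *)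
Lemma pencil_separable f u v : f != 0 -> coprimep u v -> v != 0 ->
  (size v < size u)%N ->
  exists bad : seq F, forall t, t \notin bad ->
    separable_poly (u - t *: v) /\
    forall x, root (u - t *: v) x -> ~~ root f x.
Proof.
move=> f0 cuv v0 suv; pose W := u^`() * v - u * v^`().
have W0 : W != 0 := wronskian_neq0 cuv v0 suv.
exists [seq u.[x] / v.[x] | x <- droots (W * f)] => t tgood.
have key x : root (u - t *: v) x -> ~~ root (W * f) x.
  move=> /rootP; rewrite hornerD hornerN hornerZ => /eqP; rewrite subr_eq0 => /eqP ex.
  apply: contra tgood => Wx; apply/mapP; exists x.
    by rewrite mem_droots ?mulf_neq0.
  suff vx : v.[x] != 0 by rewrite ex mulfK.
  apply/eqP => vx0; move: ex; rewrite vx0 mulr0 => ux0.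
  by move: (coprimep_root cuv (introT rootP ux0)); rewrite vx0 eqxx.
split=> [|x /key]; first rewrite unlock; last by rewrite rootM negb_or => /andP[].
apply/Pdiv.ClosedField.coprimepP => x rx; have := key x rx.
apply: contra => /eqP; rewrite derivD derivN derivZ hornerD hornerN hornerZ => /eqP.
rewrite subr_eq0 => /eqP e'; move/rootP: rx.
rewrite hornerD hornerN hornerZ => /eqP; rewrite subr_eq0 => /eqP e.
by rewrite rootM; apply/orP; left; apply/rootP; rewrite /W hornerD hornerN !hornerM e e'
  mulrAC subrr.
Qed.

(** Write f = u h and g = v h with h the gcd.  For almost all t the polynomial
    u - t v has as many distinct roots as its degree allows, none of them a root of
    f, so f - t g has deg u more distinct roots than h.  This is at least the number
    for f, and equality forces u to have simple roots, none of them shared with h.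
    A multiple root x of f is then not a root of u, so the whole power of X - x in f
    divides h, hence g. *)
Lemma pencil_droots f g : f \is monic -> (size g < size f)%N ->
  exists bad : seq F, forall t, t \notin bad ->
    (size (droots f) <= size (droots (f - t *: g)))%N /\
    ((size (droots (f - t *: g)) <= size (droots f))%N ->
     forall x, root f x -> root f^`() x ->
     forall n, ('X - x%:P) ^+ n %| f -> ('X - x%:P) ^+ n %| g).
Proof.
move=> fm sgf; have f0 := monic_neq0 fm.
have [->|g0] := eqVneq g 0.
  by exists [::] => t _; rewrite scaler0 subr0; split.
pose h := gcdp f g; have h0 : h != 0 by rewrite gcdp_eq0 (negbTE f0).
pose u := f %/ h; pose v := g %/ h.
have fE : f = u * h by rewrite /u divpK // dvdp_gcdl.
have gE : g = v * h by rewrite /v divpK // dvdp_gcdr.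
have u0 : u != 0 by apply: contraNneq f0 => u0; rewrite fE u0 mul0r.
have v0 : v != 0 by apply: contraNneq g0 => v0; rewrite gE v0 mul0r.
have cuv : coprimep u v.
  by rewrite /u /v coprimep_div_gcd // f0.
have suv : (size v < size u)%N.
  move: sgf; rewrite fE gE !size_mul //.
  by rewrite -(@prednK (size h)) ?size_poly_gt0 // !addnS /= ltn_add2r.
have [bad badP] := pencil_separable f0 cuv v0 suv.
exists bad => t /badP[sep disj].
have w0 := separable_poly_neq0 sep; set w := u - t *: v in sep disj w0 *.
have ftE : f - t *: g = w * h by rewrite {1}fE {1}gE scalerAl -mulrBl.
have sw : size w = size u.
  rewrite /w size_polyDl // size_polyN (leq_ltn_trans (size_scale_leq _ _)) //.
have nw : size (droots w) = (size u).-1 by rewrite size_droots_separable // sw.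
have disjh : uniq (droots w ++ droots h).
  rewrite cat_uniq !droots_uniq andbT /=; apply/hasPn => x.
  rewrite !mem_droots // => hx; apply/negP => /disj.
  by rewrite fE rootM hx orbT.
have lower : (size (droots w ++ droots h) <= size (droots (f - t *: g)))%N.
  apply: uniq_leq_size disjh _ => x; rewrite mem_cat ftE !mem_droots ?mulf_neq0 //.
  by rewrite rootM.
rewrite size_cat nw in lower.
have upper r : (forall x, root u x -> root h x || (x \in r)) ->
    (size (droots f) <= size (r ++ droots h))%N.
  move=> ur; apply: uniq_leq_size (droots_uniq f) _ => x.
  rewrite mem_cat !mem_droots // fE rootM.
  by case/orP => [/ur|->]; rewrite ?orbT // orbC.
split.
  apply: leq_trans lower; apply: leq_trans (upper (droots u) _) _.
    by move=> x; rewrite mem_droots // => ->; rewrite orbT.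
  by rewrite size_cat leq_add2r size_droots.
move=> eqd x fx f'x n; have ux : ~~ root u x.
  apply/negP => ux; move: (leq_trans lower eqd); rewrite leqNgt => /negP; apply.
  have [hx|hx] := boolP (root h x).
    have xu : x \in droots u by rewrite mem_droots.
    apply: leq_ltn_trans (upper (rem x (droots u)) _) _.
      move=> z uz; have [->|nzx] := eqVneq z x; first by rewrite hx.
      by rewrite mem_rem_uniq ?droots_uniq // !inE nzx mem_droots // uz orbT.
    rewrite size_cat ltn_add2r size_rem //.
    apply: leq_trans (size_droots u0).
    by rewrite ltn_predL; case: (droots u) xu.
  apply: leq_ltn_trans (upper (droots u) _) _.
    by move=> z uz; rewrite mem_droots // uz orbT.
  rewrite size_cat ltn_add2r; apply: (size_droots_double u0 ux).
  move: f'x; rewrite fE derivM rootE hornerD !hornerM (rootP ux) mul0r addr0.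
  by rewrite mulf_eq0 -!rootE (negbTE hx) orbF.
rewrite {1}fE mulrC Gauss_dvdpl; last first.
  by rewrite coprimep_expl // coprimep_sym coprimep_XsubC.
by move=> d; rewrite gE dvdp_mull.
Qed.

End DistinctRoots.

(** * Adjugates under rank one perturbations *)

Section RankOnePerturbation.
Context (R : idomainType) (k : nat).
Implicit Types (Z Y : 'M[R]_k) (u : 'cV[R]_k) (w : 'rV[R]_k).

Definition pairing w Z u : R := (w *m Z *m u) 0 0.

Lemma pairingE w Z u : w *m Z *m u = (pairing w Z u)%:M.
Proof. by rewrite [LHS]mx11_scalar. Qed.

Lemma scalemx_inj (c : R) : c != 0 -> injective (fun Z => c *: Z).
Proof.
move=> c0 Z Y /matrixP e; apply/matrixP => a b.
by have := e a b; rewrite !mxE => /(mulfI c0).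
Qed.

Lemma adj_unique Z Y : \det Z != 0 -> Z *m Y = (\det Z)%:M -> Y = \adj Z.
Proof.
move=> d0 e; have := congr1 (mulmx (\adj Z)) e.
rewrite mulmxA mul_adj_mx mul_scalar_mx mul_mx_scalar.
exact: (scalemx_inj d0).
Qed.

(** Compute the determinant of the bordered matrix with blocks Z, u, w, 1 in two ways:
    clear u with the corner 1, or clear u with the adjugate of Z. *)
Lemma det_rank1 Z u w : \det Z != 0 ->
  \det (Z - u *m w) = \det Z - pairing w (\adj Z) u.
Proof.
move=> d0.
have e1 : block_mx Z u w 1%:M =
    block_mx 1%:M u 0 1%:M *m block_mx (Z - u *m w) 0 w 1%:M.
  by rewrite mulmx_block ?(mul1mx, mulmx1, mul0mx, mulmx0, add0r, subrK).
have e2 : block_mx Z u w 1%:M *m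
    block_mx 1%:M (- (\adj Z *m u)) 0 (\det Z)%:M =
    block_mx Z 0 w ((\det Z) - pairing w (\adj Z) u)%:M.
  rewrite mulmx_block ?(mul1mx, mulmx1, mul0mx, mulmx0, addr0, mulmxN, mulmxA).
  rewrite mul_mx_adj mul_scalar_mx mul_mx_scalar addNr pairingE.
  by rewrite addrC raddfB.
have := congr1 (fun M => \det M) e2.
rewrite det_mulmx e1 det_mulmx !det_ublock !det_lblock !det1 !det_scalar1.
by rewrite !mul1r mulr1 mulrC => /(mulfI d0).
Qed.

(** The Sherman-Morrison formula cleared of denominators. *)
Lemma adj_rank1 Z u w : \det Z != 0 -> \det (Z - u *m w) != 0 ->
  \det Z *: \adj (Z - u *m w) =
    \det (Z - u *m w) *: \adj Z + (\adj Z *m u) *m (w *m \adj Z).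
Proof.
move=> d0 d1; set W := Z - u *m w in d1 *; set N := \adj Z.
set Y := _ + _.
have WN : W *m N = (\det Z)%:M - u *m (w *m N).
  by rewrite mulmxBl mul_mx_adj mulmxA.
have WNu : W *m (N *m u) = \det W *: u.
  rewrite mulmxA WN mulmxBl mul_scalar_mx -mulmxA pairingE mul_mx_scalar.
  by rewrite -scalerBl det_rank1.
have e : W *m Y = (\det W * \det Z)%:M.
  rewrite mulmxDr -scalemxAr WN [X in _ + X]mulmxA WNu -scalemxAl -scalerDr subrK.
  by rewrite scale_scalar_mx.
have := congr1 (mulmx (\adj W)) e.
rewrite mulmxA mul_adj_mx mul_scalar_mx mul_mx_scalar -scalerA.
by move/(scalemx_inj d1).
Qed.

End RankOnePerturbation.

Section DeterminantDerivative.
Context (R : comNzRingType) (k : nat).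

Lemma deriv_prod (I : eqType) (r : seq I) (f : I -> {poly R}) : uniq r ->
  (\prod_(i <- r) f i)^`() =
    \sum_(i <- r) (f i)^`() * \prod_(j <- r | j != i) f j.
Proof.
elim: r => [|a r IH] /=; first by rewrite !big_nil derivC.
move=> /andP[ar ur]; rewrite !big_cons derivM (IH ur) eqxx /=; congr (_ * _ + _).
  rewrite [RHS]big_seq_cond [LHS]big_seq; apply: eq_bigl => i.
  by case ir: (i \in r) => //=; rewrite (memPn ar).
rewrite mulr_sumr [LHS]big_seq [RHS]big_seq; apply: eq_bigr => i ir.
by rewrite big_cons (memPnC ar) // mulrCA.
Qed.

(** Jacobi's formula: differentiate the rows one at a time and expand each resulting
    determinant along the differentiated row. *)
Lemma deriv_det (Z : 'M[{poly R}]_k) : (\det Z)^`() = \tr (\adj Z *m map_mx (@deriv R) Z).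
Proof.
transitivity (\sum_i \det (\matrix_(a, b) (if a == i then (Z a b)^`() else Z a b))).
  rewrite /determinant raddf_sum exchange_big /=; apply: eq_bigr => s _.
  rewrite -mulr_sumr derivM.
  have sign_const (b : bool) : ((-1) ^+ b : {poly R})^`() = 0.
    by case: b; rewrite ?expr1 ?expr0 ?derivN -polyC1 derivC ?oppr0.
  rewrite sign_const.
  rewrite mul0r add0r; congr (_ * _).
  rewrite deriv_prod ?index_enum_uniq //; apply: eq_bigr => i _.
  rewrite [RHS](bigD1 i) //= !mxE eqxx; congr (_ * _).
  by apply: eq_bigr => j /negbTE ji; rewrite mxE ji.
rewrite /mxtrace [RHS](eq_bigr (fun j => \sum_i \adj Z j i * (Z i j)^`())); last first.
  by move=> j _; rewrite mxE; apply: eq_bigr => i _; rewrite [map_mx _ _ i j]mxE.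
rewrite [RHS]exchange_big /=; apply: eq_bigr => i _.
rewrite (expand_det_row _ i); apply: eq_bigr => j _.
rewrite !mxE eqxx mulrC; congr (_ * _); rewrite /cofactor; congr (_ * \det _).
by apply/matrixP => a b; rewrite !mxE eq_sym (negbTE (neq_lift _ _)).
Qed.

End DeterminantDerivative.

Section Transfer.
Context (F : fieldType) (k : nat).
Implicit Types (A B : 'M[F]_k) (u : 'cV[F]_k) (w : 'rV[F]_k).
Local Notation "M ^P" := (map_mx (@polyC F) M) (at level 1, format "M ^P").
Local Notation N A := (\adj (char_poly_mx A)).

(** The numerator, over the denominator [char_poly A], of the transfer function
    w (X - A)^-1 u of control theory. *)
Definition transfer A w u : {poly F} := pairing w^P (N A) u^P.

Lemma char_poly_neq0 A : char_poly A != 0.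
Proof. exact: monic_neq0 (char_poly_monic A). Qed.

Lemma transfer_is_linear_l A u : linear (fun w => transfer A w u).
Proof.
move=> c w w'; rewrite /transfer /pairing map_mxD map_mxZ !mulmxDl -!scalemxAl.
by rewrite mxE; congr (_ + _); rewrite mxE mul_polyC.
Qed.

Lemma transfer_is_linear_r A w : linear (transfer A w).
Proof.
move=> c u u'; rewrite /transfer /pairing map_mxD map_mxZ !mulmxDr -!scalemxAr.
by rewrite mxE; congr (_ + _); rewrite mxE mul_polyC.
Qed.

Lemma transferDl A w w' u : transfer A (w + w') u = transfer A w u + transfer A w' u.
Proof. by have := transfer_is_linear_l A u 1 w w'; rewrite !scale1r. Qed.

Lemma transferDr A w u u' : transfer A w (u + u') = transfer A w u + transfer A w u'.
Proof. by have := transfer_is_linear_r A w 1 u u'; rewrite !scale1r. Qed.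

Lemma transfer0l A u : transfer A 0 u = 0.
Proof. by rewrite /transfer /pairing map_mx0 !mul0mx mxE. Qed.

Lemma transfer0r A w : transfer A w 0 = 0.
Proof. by rewrite /transfer /pairing map_mx0 !mulmx0 mxE. Qed.

Lemma transferZl A c w u : transfer A (c *: w) u = c *: transfer A w u.
Proof.
by have := transfer_is_linear_l A u c w 0; rewrite transfer0l !addr0.
Qed.

Lemma transferZr A c w u : transfer A w (c *: u) = c *: transfer A w u.
Proof.
by have := transfer_is_linear_r A w c u 0; rewrite transfer0r !addr0.
Qed.

Lemma char_poly_mx_rank1 A u w (t : F) :
  char_poly_mx (A + t *: (u *m w)) = char_poly_mx A - (t *: u)^P *m w^P.
Proof. by rewrite /char_poly_mx map_mxD opprD addrA scalemxAl map_mxM. Qed.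

Lemma char_poly_rank1 A u w (t : F) :
  char_poly (A + t *: (u *m w)) = char_poly A - t *: transfer A w u.
Proof.
by rewrite /char_poly char_poly_mx_rank1 det_rank1 ?char_poly_neq0 // -transferZr.
Qed.

Lemma transfer_rank1 A u w (t : F) w' u' :
  char_poly A * transfer (A + t *: (u *m w)) w' u' =
    (char_poly A - t *: transfer A w u) * transfer A w' u' +
    t *: (transfer A w' u * transfer A w u').
Proof.
have d1 := char_poly_neq0 (A + t *: (u *m w)).
have scale_pairing (c : {poly F}) (p : 'rV_k) X (q : 'cV_k) :
    c * pairing p X q = pairing p (c *: X) q.
  by rewrite /pairing -scalemxAr -scalemxAl [RHS]mxE.
rewrite [X in _ * X]/transfer scale_pairing char_poly_mx_rank1.
rewrite adj_rank1 ?char_poly_neq0 -?char_poly_mx_rank1 //.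
rewrite -/(char_poly (A + t *: (u *m w))) /pairing mulmxDr mulmxDl mxE.
congr (_ + _); first by rewrite -scalemxAr -scalemxAl [LHS]mxE char_poly_rank1.
rewrite scalerAl -transferZr -[_ *m _ *m u'^P]mulmxA -[_ *m (w^P *m _) *m _]mulmxA.
rewrite mulmxA [_ *m (N A *m (t *: u)^P)]mulmxA !pairingE mul_scalar_mx.
by rewrite !mxE eqxx mulr1n.
Qed.

(** It is the difference of two monic polynomials of degree k, by [char_poly_rank1]. *)
Lemma size_transfer A w u : (size (transfer A w u) < size (char_poly A))%N.
Proof.
have -> : transfer A w u = char_poly A - char_poly (A + 1 *: (u *m w)).
  by rewrite char_poly_rank1 scale1r opprB addrC subrK.
rewrite size_char_poly ltnS; apply/leq_sizeP => j; rewrite leq_eqVlt coefB.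
case/orP=> [/eqP <-|kj].
  have lc (M : 'M[F]_k) : (char_poly M)`_k = 1 :> F.
    by rewrite -(monicP (char_poly_monic M)) lead_coefE size_char_poly.
  by rewrite !lc subrr.
by rewrite !nth_default ?subrr // size_char_poly.
Qed.

Lemma deriv_char_poly A : (char_poly A)^`() = \tr (N A).
Proof.
rewrite /char_poly deriv_det; congr (\tr _); rewrite -[RHS]mulmx1; congr (_ *m _).
by apply/matrixP => a b; rewrite !mxE derivB derivC subr0 derivMn derivX.
Qed.

(** Differentiating N (X - A) = D gives N' (X - A) + N = D'; multiply by N and take
    the trace, using tr N = D'. *)
Lemma tr_adj_sqr A :
  \tr (N A *m N A) = (char_poly A)^`() ^+ 2 - char_poly A * (char_poly A)^`()^`().
Proof.
set D := char_poly A; set Z := char_poly_mx A.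
pose N' := map_mx (@deriv F) (N A).
have dM (X Y : 'M[{poly F}]_k) : map_mx (@deriv F) (X *m Y) =
    map_mx (@deriv F) X *m Y + X *m map_mx (@deriv F) Y.
  apply/matrixP => a b; rewrite !mxE raddf_sum -big_split /=; apply: eq_bigr => c _.
  by rewrite derivM !mxE.
have Z1 : map_mx (@deriv F) Z = 1%:M.
  by apply/matrixP => a b; rewrite !mxE derivB derivC subr0 derivMn derivX.
have e : N' *m Z + N A = (D^`())%:M.
  have := congr1 (map_mx (@deriv F)) (mul_adj_mx Z); rewrite dM Z1 mulmx1 => ->.
  by apply/matrixP => a b; rewrite !mxE derivMn.
have := congr1 (fun X => \tr (X *m N A)) e.
rewrite mulmxDl -mulmxA mul_mx_adj mul_mx_scalar mul_scalar_mx mxtraceD !mxtraceZ.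
have -> : \tr N' = D^`()^`().
  rewrite deriv_char_poly /mxtrace raddf_sum /=; apply: eq_bigr => i _.
  by rewrite mxE.
rewrite -deriv_char_poly -/D expr2 => <-.
by rewrite addrC addKr.
Qed.

(** With N the adjugate, D (B N - N B) = - N [A, B] N.  The moment equation turns the
    sum over a of j_a N [A, B] N i_a into products of the T_ab and tau times the sum
    of the j_a N^2 i_a, and the latter is - tau tr N^2 because N [A, B] N is
    proportional to a commutator and thus has trace zero. *)
Lemma commutator_curvature A B (tau : F) (i1 i2 : 'cV[F]_k) (j1 j2 : 'rV[F]_k) :
  A *m B - B *m A = tau%:M + (i1 *m j1 + i2 *m j2) ->
  char_poly A * (transfer A (j2 *m B) i2 - transfer A j1 (B *m i1)) +
  char_poly A * (transfer A (j1 *m B) i1 - transfer A j2 (B *m i2)) =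
  tau ^+ 2 *: \tr (N A *m N A) - transfer A j1 i1 ^+ 2 - transfer A j2 i2 ^+ 2
  - 2%:R * (transfer A j1 i2 * transfer A j2 i1).
Proof.
move=> moment; pose n := N A; pose K := (i1 *m j1 + i2 *m j2)^P.
have E : char_poly A *: (B^P *m n - n *m B^P) = - (n *m (tau%:P%:M + K) *m n).
  have -> : tau%:P%:M + K = B^P *m char_poly_mx A - char_poly_mx A *m B^P.
    rewrite /K -map_scalar_mx -map_mxD -moment /char_poly_mx mulmxBl mulmxBr.
    by rewrite scalar_mxC opprB [RHS]addrC subrKA map_mxB !map_mxM.
  have Zn : char_poly_mx A *m n = (char_poly A)%:M := mul_mx_adj _.
  have nZ : n *m char_poly_mx A = (char_poly A)%:M := mul_adj_mx _.
  rewrite mulmxBr mulmxBl !mulmxA nZ -[_ *m _ *m n]mulmxA Zn.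
  by rewrite mul_scalar_mx mul_mx_scalar -scalemxAl -scalerBr -scalerN opprB.
have tE (w : 'rV_k) X (u : 'cV_k) : pairing w X u = \tr (X *m (u *m w)).
  by rewrite /pairing -trace_mx11 -mulmxA mxtrace_mulC mulmxA.
have T w u X : pairing w^P X u^P = \tr (X *m (u *m w)^P) by rewrite tE map_mxM.
have lhs w u : transfer A (w *m B) u - transfer A w (B *m u) =
    \tr ((B^P *m n - n *m B^P) *m (u *m w)^P).
  by rewrite mulmxBl raddfB /= -!T /transfer /pairing !map_mxM !mulmxA.
have tr0 : tau *: \tr (n *m n) + \tr (n *m n *m K) = 0.
  have := congr1 mxtrace E; rewrite mxtraceZ raddfB /= mxtrace_mulC subrr mulr0.
  rewrite mulmxDr mulmxDl mul_mx_scalar -scalemxAl raddfN /= mxtraceD mxtraceZ.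
  move/eqP; rewrite eq_sym oppr_eq0 mul_polyC => /eqP.
  by rewrite [\tr (n *m K *m n)]mxtrace_mulC mulmxA.
have sum : char_poly A * \tr ((B^P *m n - n *m B^P) *m K) =
    - (tau *: \tr (n *m n *m K) + \tr (n *m K *m n *m K)).
  rewrite -mxtraceZ scalemxAl E mulNmx raddfN /= mulmxDr !mulmxDl mul_mx_scalar.
  by rewrite -!scalemxAl mxtraceD mxtraceZ mul_polyC.
have KE : K = (i1 *m j1)^P + (i2 *m j2)^P by rewrite /K map_mxD.
have sq : \tr (n *m K *m n *m K) = transfer A j1 i1 ^+ 2 + transfer A j2 i2 ^+ 2
    + 2%:R * (transfer A j1 i2 * transfer A j2 i1).
  have pp (w w' : 'rV_k) (u u' : 'cV_k) :
      \tr (n *m (u *m w)^P *m n *m (u' *m w')^P) = transfer A w u' * transfer A w' u.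
    have e : w'^P *m (n *m (u^P *m w^P) *m n) *m u'^P =
        (w'^P *m n *m u^P) *m (w^P *m n *m u'^P) by rewrite !mulmxA.
    by rewrite -T /pairing map_mxM e !pairingE -scalar_mxM mxE eqxx mulr1n mulrC.
  rewrite KE !(mulmxDr, mulmxDl, mxtraceD) !pp.
  by ring.
have tr1 : \tr (n *m n *m K) = - (tau *: \tr (n *m n)).
  by apply/eqP; rewrite -addr_eq0 addrC tr0.
have regroup (p q r s : {poly F}) : (p - q) + (r - s) = (r - q) + (p - s) by ring.
rewrite -mulrDr regroup !lhs -mxtraceD -mulmxDr -KE sum sq tr1.
by rewrite scalerN scalerA -expr2 !opprD opprK addrA addrA.
Qed.

End Transfer.

(** * Every orbit contains a matrix with distinct eigenvalues *)

Section Divisibility.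
Context (F : numFieldType).
Implicit Types (p q D E : {poly F}) (x : F).

Lemma poly_eq0_cofinite p (bad : seq F) :
  (forall t, t \notin bad -> p.[t] = 0) -> p = 0.
Proof.
move=> pv; pose q := p * \prod_(b <- bad) ('X - b%:P).
have qv t : q.[t] = 0.
  rewrite hornerM; have [tb|/pv ->] := boolP (t \in bad); last by rewrite mul0r.
  have /rootP -> : root (\prod_(b <- bad) ('X - b%:P)) t by rewrite root_prod_XsubC.
  by rewrite mulr0.
have q0 : q = 0.
  apply/eqP/negPn/negP => q0.
  have := @max_poly_roots _ q [seq n%:R | n <- iota 0 (size q)] q0.
  rewrite size_map size_iota ltnn => H; suff: false by []; apply: H.
    by apply/allP => t _; apply/rootP.
  rewrite map_inj_uniq ?iota_uniq // => m n /eqP.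
  by rewrite Num.Theory.eqr_nat => /eqP.
have m0 := monic_neq0 (monic_prod_XsubC bad xpredT id).
by move/eqP: q0; rewrite mulf_eq0 (negbTE m0) orbF => /eqP.
Qed.

Lemma exists_notin (bad : seq F) : exists t, t \notin bad.
Proof.
apply: contrapT => H; have : (1 : {poly F}) = 0.
  by apply: (@poly_eq0_cofinite _ bad) => t tb; case: H; exists t.
by move/eqP; rewrite oner_eq0.
Qed.

(** Each coefficient of the remainder modulo q is a polynomial in t with infinitely
    many roots. *)
Lemma dvdp_pencil_coefs q d (c : nat -> {poly F}) (bad : seq F) :
  (forall t, t \notin bad -> q %| \sum_(i < d) t ^+ i *: c i) ->
  forall i, (i < d)%N -> q %| c i.
Proof.
move=> qd i id; rewrite /dvdp; apply/eqP/polyP => m; rewrite coef0.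
pose P := \poly_(l < d) (c l %% q)`_m.
suff P0 : P = 0 by have := congr1 (fun p => p`_i) P0; rewrite coef_poly id coef0.
apply: (@poly_eq0_cofinite _ bad) => t /qd /modp_eq0P e.
have := congr1 (fun p => p`_m) e; rewrite coef0 => <-.
rewrite (big_morph (fun p => p %% q) (@modpD _ q) (mod0p q)) coef_sum horner_poly.
by apply: eq_bigr => l _; rewrite modpZl coefZ mulrC.
Qed.

Lemma dvdp_XsubC_sqr p x : ('X - x%:P) ^+ 2 %| p -> root p x /\ root p^`() x.
Proof.
move=> /dvdpP[q ->]; split; first by rewrite rootM root_exp_XsubC eqxx orbT.
rewrite expr2 mulrA derivM derivXsubC rootE hornerD !hornerM hornerXsubC subrr.
by rewrite !mulr0 mul0r addr0.
Qed.

(** The polynomial D'^2 - D D'' is - D^2 times the derivative of D' / D, and D' / D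
    has residue n at x; so it vanishes at x to the order 2 n - 2.  To avoid the
    exponents n - 1 and n - 2, the derivatives are multiplied by X - x. *)
Lemma log_curvature_order D E x n : (0 < n)%N -> ~~ root E x ->
  D = ('X - x%:P) ^+ n * E ->
  ~~ (('X - x%:P) ^+ (2 * n) %| D^`() ^+ 2 - D * D^`()^`()).
Proof.
move=> n0 Ex DE; set Y := 'X - x%:P in DE *.
have Y' : Y^`() = 1 by rewrite derivXsubC.
have Yn : Y * (Y ^+ n)^`() = n%:R * Y ^+ n.
  by rewrite deriv_exp Y' mul1r mulrnAr -exprS prednK // mulr_natl.
pose G := n%:R * E + Y * E^`().
have YD' : Y * D^`() = Y ^+ n * G.
  by rewrite DE derivM mulrDr mulrA Yn /G; ring.
have YD'' : Y ^+ 2 * D^`()^`() = Y ^+ n * (n%:R * G + Y * G^`() - G).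
  have e : Y * (D^`() + Y * D^`()^`()) = Y * (Y ^+ n)^`() * G + Y * Y ^+ n * G^`().
    by have := congr1 (fun p => Y * p^`()) YD'; rewrite !derivM Y' mul1r => ->; ring.
  have -> : Y ^+ 2 * D^`()^`() = Y * (D^`() + Y * D^`()^`()) - Y * D^`() by ring.
  by rewrite e YD' Yn; ring.
apply/negP => /dvdpP[Q e].
have Y0 : Y != 0 by rewrite polyXsubC_eq0.
have : Y ^+ 2 * (D^`() ^+ 2 - D * D^`()^`()) =
    Y ^+ (2 * n) * (G ^+ 2 - E * (n%:R * G + Y * G^`() - G)).
  rewrite mulrBr -exprMn YD' mulrCA YD'' DE mulnC exprM; ring.
have -> : Y ^+ 2 * (D^`() ^+ 2 - D * D^`()^`()) = Y ^+ (2 * n) * (Y ^+ 2 * Q).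
  by rewrite e; ring.
move=> /(mulfI (expf_neq0 (2 * n) Y0)) /(congr1 (fun p : {poly F} => p.[x])) H.
have Yx : Y.[x] = 0 by rewrite hornerXsubC subrr.
have Gx : G.[x] = n%:R * E.[x].
  by rewrite hornerD !hornerM Yx mul0r addr0 -polyC_natr hornerC.
clearbody G; clearbody Y; move: H.
rewrite !(hornerD, hornerN, hornerM, horner_exp) Yx Gx -polyC_natr hornerC.
rewrite !mul0r addr0 => /eqP; rewrite eq_sym.
have -> : n%:R * E.[x] * (n%:R * E.[x]) - E.[x] * (n%:R * (n%:R * E.[x]) - n%:R * E.[x])
    = n%:R * E.[x] ^+ 2 by ring.
by rewrite mulf_eq0 Num.Theory.pnatr_eq0 expf_eq0 /= -rootE (negbTE Ex) eqn0Ngt n0.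
Qed.

End Divisibility.

Section DistinctEigenvalues.
Context (F : numClosedFieldType) (k : nat).
Implicit Types (q : quad F k) (x t : F).

Definition ndist q := size (droots (char_poly q.1.1.1)).

Definition maximal q := forall q', orb q q' -> (ndist q' <= ndist q)%N.

Lemma maximal_orb q q' : maximal q -> orb q q' -> (ndist q <= ndist q')%N -> maximal q'.
Proof.
by move=> qmax qq' le q'' q'q''; apply: leq_trans le; apply/qmax/(orb_trans qq').
Qed.

Lemma maximal_exists q : exists2 q', orb q q' & maximal q'.
Proof.
pose P m := `[< exists2 q', orb q q' & ndist q' = m >].
have P0 : exists m, P m by exists (ndist q); apply/asboolP; exists q => //; exact: orb_refl.
have Pk m : P m -> (m <= k)%N.
  move=> /asboolP[q' _ <-]; apply: leq_trans (size_droots (char_poly_neq0 _)) _.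
  by rewrite size_char_poly.
have [m /asboolP[q' qq' <-] mmax] := ex_maxnP P0 Pk.
exists q' => // q'' q'q''; apply: mmax; apply/asboolP; exists q'' => //.
exact: orb_trans q'q''.
Qed.

Section FirstOrder.
Context (A B : 'M[F]_k) (i1 i2 : 'cV[F]_k) (j1 j2 : 'rV[F]_k).
Context (qmax : maximal (mkq A B i1 i2 j1 j2)).

(** Almost every feedback move leads to a point with at least as many eigenvalues,
    hence to a maximal one, and equality holds in [pencil_droots]. *)
Lemma maximal_feedback : exists bad : seq F, forall t, t \notin bad ->
  maximal (mkq (A + t *: (i1 *m j2)) B i1 (i2 - t *: (B *m i1)) (j1 + t *: (j2 *m B)) j2)
  /\ forall x n, ('X - x%:P) ^+ 2 %| char_poly A -> ('X - x%:P) ^+ n %| char_poly A ->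
     ('X - x%:P) ^+ n %| transfer A j2 i1.
Proof.
have [bad badP] := pencil_droots (char_poly_monic A) (size_transfer A j2 i1).
exists bad => t /badP; rewrite -char_poly_rank1 => -[le eq].
have qq' := orb_feedback A B i1 i2 j1 j2 t.
split=> [|x n /dvdp_XsubC_sqr[rx r'x] d]; first exact: maximal_orb qq' le.
exact: eq (qmax qq') x rx r'x n d.
Qed.

Lemma maximal_dvd x n : ('X - x%:P) ^+ 2 %| char_poly A ->
  ('X - x%:P) ^+ n %| char_poly A -> ('X - x%:P) ^+ n %| transfer A j2 i1.
Proof.
have [bad badP] := maximal_feedback; move=> d2 dn.
have [t tb] := exists_notin bad.
by have [_] := badP t tb; apply.
Qed.

End FirstOrder.

Section SecondOrder.
Context (A B : 'M[F]_k) (i1 i2 : 'cV[F]_k) (j1 j2 : 'rV[F]_k).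
Context (qmax : maximal (mkq A B i1 i2 j1 j2)).

Lemma maximal_swap : maximal (mkq A B i2 i1 j2 j1).
Proof. exact: maximal_orb qmax (orb_swap _ _ _ _ _ _) (leqnn _). Qed.

(** Apply [maximal_dvd] after adding i2 to i1 and subtracting j1 from j2. *)
Lemma maximal_dvd_diff x n : ('X - x%:P) ^+ 2 %| char_poly A ->
  ('X - x%:P) ^+ n %| char_poly A ->
  ('X - x%:P) ^+ n %| transfer A j1 i1 - transfer A j2 i2.
Proof.
move=> d2 dn.
have h : orb (mkq A B i1 i2 j1 j2) (mkq A B (i1 + i2) i2 j1 (j2 - j1)).
  apply: orb_trans (orb_swap _ _ _ _ _ _) _.
  apply: orb_trans (orb_shear _ _ _ _ _ _ (-1) 0) _.
  apply: orb_trans (orb_swap _ _ _ _ _ _) _.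
  rewrite /= scaler0 subr0 expr0 mulmx1 mul1mx !scaleN1r opprK.
  exact: orb_refl.
have := maximal_dvd (maximal_orb qmax h (leqnn _)) d2 dn.
rewrite transferDr !transferDl -[- j1]scaleN1r !transferZl !scaleN1r => d.
have := maximal_dvd qmax d2 dn; have := maximal_dvd maximal_swap d2 dn => d12 d21.
have -> : transfer A j1 i1 - transfer A j2 i2 = transfer A j2 i1 - transfer A j1 i2
  - (transfer A j2 i1 - transfer A j1 i1 + (transfer A j2 i2 - transfer A j1 i2)).
  by move: (transfer A j1 i2) (transfer A j2 i1) (transfer A j1 i1) (transfer A j2 i2);
    move=> *; ring.
by rewrite !dvdp_sub.
Qed.

(** For almost all t the feedback move leads to a maximal point, so T_12 at the new
    point is divisible by the n-th power.  Its product with D is a cubic polynomial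
    in t, by [transfer_rank1]; the claim concerns the coefficient of t. *)
Lemma maximal_second_order x n : ('X - x%:P) ^+ 2 %| char_poly A ->
  ('X - x%:P) ^+ n %| char_poly A ->
  ('X - x%:P) ^+ (2 * n) %|
    char_poly A * (transfer A (j2 *m B) i2 - transfer A j1 (B *m i1))
    - transfer A j2 i1 * transfer A j1 i2 + transfer A j1 i1 * transfer A j2 i2.
Proof.
move=> d2 dn; have [bad badP] := maximal_feedback qmax.
pose D := char_poly A; pose T := transfer A.
pose c1 := D * (T (j2 *m B) i2 - T j1 (B *m i1)) - T j2 i1 * T j1 i2
  + T j1 i1 * T j2 i2.
pose c2 := - T j2 i1 * (T (j2 *m B) i2 - T j1 (B *m i1)) - D * T (j2 *m B) (B *m i1)
  + T (j2 *m B) i1 * T j2 i2 - T j1 i1 * T j2 (B *m i1).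
pose c3 := T j2 i1 * T (j2 *m B) (B *m i1) - T (j2 *m B) i1 * T j2 (B *m i1).
pose c i := nth 0 [:: D * T j1 i2; c1; c2; c3] i.
apply: (@dvdp_pencil_coefs _ _ 4 c bad _ 1) => // t tb.
have [qtmax dT] := badP t tb.
have dD m : ('X - x%:P) ^+ m %| char_poly A ->
    ('X - x%:P) ^+ m %| char_poly (A + t *: (i1 *m j2)).
  by move=> dm; rewrite char_poly_rank1 dvdp_sub // -mul_polyC dvdp_mull // dT.
have d := maximal_dvd (maximal_orb qtmax (orb_swap _ _ _ _ _ _) (leqnn _)) (dD _ d2) (dD _ dn).
have -> : \sum_(i < 4) t ^+ i *: c i =
    D * transfer (A + t *: (i1 *m j2)) (j1 + t *: (j2 *m B)) (i2 - t *: (B *m i1)).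
  rewrite transfer_rank1 -!scaleNr !(transferDl, transferDr, transferZl, transferZr).
  rewrite !big_ord_recl big_ord0 /c /c1 /c2 /c3 /= /bump /= -!mul_polyC !polyCN.
  rewrite !polyC_exp /D /T.
  move: (transfer A j1 i2) (transfer A j2 i1) (transfer A j1 i1) (transfer A j2 i2)
    (transfer A (j2 *m B) i2) (transfer A j1 (B *m i1)) (transfer A (j2 *m B) (B *m i1))
    (transfer A (j2 *m B) i1) (transfer A j2 (B *m i1)) (char_poly A) t%:P.
  by move=> *; ring.
by rewrite mul2n -addnn exprD dvdp_mul.
Qed.

End SecondOrder.

(** At a multiple root of order n of D, the first-order conditions and the two
    second-order ones make tau^2 tr N^2 divisible by (X - x)^(2 n), against
    [log_curvature_order]. *)
Lemma separable_in_orbit q (tau : F) : tau != 0 -> moment q = tau%:M ->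
  exists2 q', orb q q' & separable_poly (char_poly q'.1.1.1).
Proof.
move=> tau0 mq; have [q' qq' qmax] := maximal_exists q; exists q' => //.
have mq' := orb_moment qq' mq; have [A [B [i1 [i2 [j1 [j2 e]]]]]] := quadE q'.
move: qmax mq'; rewrite {qq'}e moment_mkq /= => qmax /eqP; rewrite subr_eq => /eqP mq'.
rewrite unlock; apply/Pdiv.ClosedField.coprimepP => x rx; apply/negP => r'x.
have [n [E]] := multiplicity_XsubC (char_poly A) x.
rewrite char_poly_neq0 /= => Ex; rewrite mulrC => DE.
have n2 : (1 < n)%N.
  case: n DE => [|[|n]] // DE.
    by move: rx; rewrite DE mul1r (negbTE Ex).
  move: r'x; rewrite DE expr1 derivM derivXsubC mul1r.
  by rewrite hornerD hornerM hornerXsubC subrr mul0r addr0 -rootE (negbTE Ex).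
have dn : ('X - x%:P) ^+ n %| char_poly A by rewrite DE dvdp_mulr.
have d2 : ('X - x%:P) ^+ 2 %| char_poly A by rewrite (dvdp_trans _ dn) ?dvdp_exp2l.
(* Exchanging the indices 1 and 2 gives another maximal point with the same A. *)
have c12 := maximal_second_order qmax d2 dn.
have c21 := maximal_second_order (maximal_swap qmax) d2 dn.
have d12 := maximal_dvd (maximal_swap qmax) d2 dn.
have d21 := maximal_dvd qmax d2 dn.
have d11 := maximal_dvd_diff qmax d2 dn.
have mul2 (p r : {poly F}) : ('X - x%:P) ^+ n %| p -> ('X - x%:P) ^+ n %| r ->
    ('X - x%:P) ^+ (2 * n) %| p * r.
  by rewrite mul2n -addnn exprD; exact: dvdp_mul.
have /negP := log_curvature_order (ltnW n2) Ex DE; apply.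
rewrite -tr_adj_sqr -(@dvdpZr _ (tau ^+ 2)) ?expf_neq0 //.
have := commutator_curvature mq'.
set s := transfer A (j2 *m B) i2 - _ in c12 *; set s' := _ - transfer A j2 _ in c21 *.
set S := _ *: _ => e.
have -> : S = (char_poly A * s - transfer A j2 i1 * transfer A j1 i2
      + transfer A j1 i1 * transfer A j2 i2)
    + (char_poly A * s' - transfer A j1 i2 * transfer A j2 i1
      + transfer A j2 i2 * transfer A j1 i1)
    + (transfer A j1 i1 - transfer A j2 i2) * (transfer A j1 i1 - transfer A j2 i2)
    + 4%:R * (transfer A j1 i2 * transfer A j2 i1).
  have -> : S = char_poly A * s + char_poly A * s' + transfer A j1 i1 ^+ 2
      + transfer A j2 i2 ^+ 2 + 2%:R * (transfer A j1 i2 * transfer A j2 i1).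
    clear c12 c21.
    move: (transfer A j1 i2) (transfer A j2 i1) (transfer A j1 i1) (transfer A j2 i2)
      (char_poly A) s s' S e => a b c d D r r' S' ->; ring.
  clear; move: (transfer A j1 i2) (transfer A j2 i1) (transfer A j1 i1) (transfer A j2 i2)
    (char_poly A) s s' => *; ring.
apply: dvdp_add; last by apply: dvdp_mull; exact: mul2.
apply: dvdp_add; last exact: mul2.
exact: dvdp_add.
Qed.

End DistinctEigenvalues.

(** * Normal forms over a fixed spectrum *)

Section Interpolation.
Context (F : fieldType) (k : nat).
Implicit Types (d b : 'I_k -> F).

Lemma Vandermonde_unit d : injective d -> Vandermonde k (\row_s d s) \in unitmx.
Proof.
move=> dI; rewrite unitmxE det_Vandermonde unitfE.
apply/prodf_neq0 => i _; apply/prodf_neq0 => j ij.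
by rewrite !mxE subr_eq0 (inj_eq dI) eq_sym -val_eqE ltn_eqF.
Qed.

Lemma interpolation d b : injective d ->
  exists c : nat -> F, forall s, \sum_(n < k) c n * d s ^+ n = b s.
Proof.
move=> /Vandermonde_unit VU; pose r := (\row_s b s) *m invmx (Vandermonde k (\row_s d s)).
exists (fun n => (rVpoly r)`_n) => s.
have := congr1 (fun M : 'rV_k => M 0 s) (mulmxKV VU (\row_s b s)); rewrite /= -/r !mxE => <-.
by apply: eq_bigr => n _; rewrite coef_rVpoly_ord !mxE.
Qed.

Lemma diag_mxX d n :
  diag_mx (\row_s d s) ^+ n = diag_mx (\row_s (d s ^+ n)) :> 'M[F]_k.
Proof.
elim: n => [|n IH].
  by rewrite expr0; apply/matrixP => r s; rewrite !mxE expr0.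
rewrite exprS IH -mulmxE mulmx_diag; congr diag_mx; apply/rowP => s.
by rewrite !mxE exprS.
Qed.

(** The eigenvectors are independent because polynomials in A project any linear
    combination of them onto each of its terms. *)
Lemma diagonalize (A : 'M[F]_k) d : injective d ->
  char_poly A = \prod_s ('X - (d s)%:P) ->
  exists2 P : 'M[F]_k, P \in unitmx & P *m A *m invmx P = diag_mx (\row_s d s).
Proof.
move=> dI cA.
have /(_ _)/eigenvalueP/cid2 eigen s : eigenvalue A (d s).
  by rewrite eigenvalue_root_char cA (bigD1 s) //= rootM root_XsubC eqxx.
pose v s := sval (eigen s).
have vA s : v s *m A = d s *: v s by rewrite /v; case: (eigen s).
have v0 s : v s != 0 by rewrite /v; case: (eigen s).
pose P : 'M[F]_k := \matrix_s v s.
have PA : P *m A = diag_mx (\row_s d s) *m P.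
  apply/row_matrixP => s.
  by rewrite !row_mul rowK vA row_diag_mx mxE -scalemxAl -rowE rowK.
suff PU : P \in unitmx by exists P => //; rewrite PA mulmxK.
rewrite -row_free_unit; apply: inj_row_free => c cP.
have cPn n : c *m diag_mx (\row_s d s) ^+ n *m P = 0.
  elim: n => [|n IH]; first by rewrite expr0 mulmx1.
  by rewrite exprSr -mulmxE mulmxA -mulmxA -PA mulmxA IH mul0mx.
apply/rowP => s; rewrite mxE; have [a aP] := interpolation (fun r => (r == s)%:R) dI.
have e : \sum_(n < k) a n *: diag_mx (\row_s d s) ^+ n =
    diag_mx (delta_mx 0 s : 'rV[F]_k).
  rewrite (eq_bigr (fun n : 'I_k => diag_mx (\row_r (a n * d r ^+ n)))) => [|n _].
    rewrite -raddf_sum /=; congr diag_mx; apply/rowP => r.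
    by rewrite summxE !mxE eqxx /= -aP; apply: eq_bigr => n _; rewrite mxE.
  by rewrite diag_mxX -linearZ; congr diag_mx; apply/rowP => r; rewrite !mxE.
have : c *m diag_mx (delta_mx 0 s : 'rV[F]_k) *m P = 0.
  rewrite -e mulmx_sumr mulmx_suml big1 // => n _.
  by rewrite -scalemxAr -scalemxAl cPn scaler0.
have -> : c *m diag_mx (delta_mx 0 s) = c 0 s *: delta_mx 0 s.
  apply/rowP => r; rewrite mul_mx_diag !mxE eqxx /=.
  by case: eqVneq => [->|]; rewrite ?mulr0.
rewrite -scalemxAl -rowE rowK => /eqP; rewrite scalemx_eq0 (negbTE (v0 s)) orbF.
by move/eqP.
Qed.

End Interpolation.

Section PolynomialMoves.
Context (F : fieldType) (k : nat).
Implicit Types (A B : 'M[F]_k) (i : 'cV[F]_k) (j : 'rV[F]_k) (c : nat -> F).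

Lemma orb_translate_sum A B i1 i2 j1 j2 c m :
  orb (mkq A B i1 i2 j1 j2) (mkq A (B + \sum_(n < m) c n *: A ^+ n) i1 i2 j1 j2).
Proof.
elim: m => [|m IH]; first by rewrite big_ord0 addr0; exact: orb_refl.
by rewrite big_ord_recr /= addrA; apply: orb_trans IH _; exact: orb_translate.
Qed.

Lemma orb_shear_sum A B i1 i2 j1 j2 c m : exists B',
  orb (mkq A B i1 i2 j1 j2)
      (mkq A B' i1 (i2 - \sum_(n < m) c n *: (A ^+ n *m i1))
           (j1 + \sum_(n < m) c n *: (j2 *m A ^+ n)) j2).
Proof.
elim: m => [|m [B' IH]].
  by exists B; rewrite !big_ord0 addr0 subr0; exact: orb_refl.
exists (B' - c m *: hook_mx A i1 j2 m); rewrite !big_ord_recr /= opprD !addrA.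
by apply: orb_trans IH _; exact: orb_shear.
Qed.

(** The shears with the indices 1 and 2 exchanged. *)
Lemma orb_coshear_sum A B i1 i2 j1 j2 c m : exists B',
  orb (mkq A B i1 i2 j1 j2)
      (mkq A B' (i1 - \sum_(n < m) c n *: (A ^+ n *m i2)) i2
           j1 (j2 + \sum_(n < m) c n *: (j1 *m A ^+ n))).
Proof.
have [B' o] := orb_shear_sum A B i2 i1 j2 j1 c m; exists B'.
apply: orb_trans (orb_swap _ _ _ _ _ _) _; apply: orb_trans o _; exact: orb_swap.
Qed.

End PolynomialMoves.

Section NormalForm.
Context (F : numFieldType) (k : nat) (tau : F).
Implicit Types (d : 'I_k -> F) (w : 'rV[F]_k).

(** The Calogero-Moser matrix: the only matrix with zero diagonal solving the moment
    equation when A is diagonal with distinct entries, i1 = (1, ..., 1), i2 = 0 and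
    j1 = (- tau, ..., - tau). *)
Definition cm_mx d : 'M[F]_k :=
  \matrix_(s, r) if s == r then 0 else - tau / (d s - d r).

Definition normal_form d w : quad F k :=
  mkq (diag_mx (\row_s d s)) (cm_mx d) (const_mx 1) 0 (const_mx (- tau)) w.

Lemma diag_commutator d (B : 'M[F]_k) s r :
  (diag_mx (\row_s d s) *m B - B *m diag_mx (\row_s d s)) s r = (d s - d r) * B s r.
Proof. by rewrite mul_diag_mx mul_mx_diag !mxE mulrBl (mulrC (B s r)). Qed.

Lemma normal_form_moment d w : injective d -> moment (normal_form d w) = tau%:M.
Proof.
move=> dI; rewrite moment_mkq mul0mx addr0; apply/matrixP => s r.
rewrite mxE diag_commutator !mxE big_ord1 !mxE mul1r opprK.
have [->|sr] := eqVneq s r; first by rewrite mulr0 add0r.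
by rewrite mulrC divfK ?addNr // subr_eq0 (inj_eq dI).
Qed.

(** Each normalization step controls only some of the matrices; the others are
    recovered from the moment equation, which every step preserves. *)
Lemma to_normal_form q d w : injective d -> tau != 0 -> moment q = tau%:M ->
  char_poly q.1.1.1 = \prod_s ('X - (d s)%:P) -> orb q (normal_form d w).
Proof.
move=> dI tau0; have [A [B [i1 [i2 [j1 [j2 ->]]]]]] := quadE q => mq /= cA.
pose L := diag_mx (\row_s d s) : 'M[F]_k.
have [P PU PA] := diagonalize dI cA.
have o1 := orb_gl (mkq A B i1 i2 j1 j2) PU; rewrite gl_act_mkq PA -/L in o1.
have m1 := orb_moment o1 mq; apply: (orb_trans o1); move: m1 {o1 mq cA PA}.
move: (P *m B *m _) (P *m i1) (P *m i2) (j1 *m _) (j2 *m _) => {}B {}i1 {}i2 {}j1 {}j2 m1.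
have diag_moment B' (u1 u2 : 'cV_k) (w1 w2 : 'rV_k) s :
    moment (mkq L B' u1 u2 w1 w2) = tau%:M ->
    u1 s 0 * w1 0 s + u2 s 0 * w2 0 s = - tau.
  rewrite moment_mkq => /matrixP/(_ s s).
  rewrite mxE diag_commutator subrr mul0r add0r !mxE !big_ord1 eqxx mulr1n.
  by move=> <-; rewrite opprK.
(* The values of t to avoid are those where an entry of i1 - t i2 vanishes. *)
have [t tb] := exists_notin [seq i1 s 0 / i2 s 0 | s <- enum 'I_k].
have o2 : orb (mkq L B i1 i2 j1 j2) (mkq L B (i1 - t *: i2) i2 j1 (j2 + t *: j1)).
  apply: orb_trans (orb_swap _ _ _ _ _ _) _.
  apply: orb_trans (orb_shear _ _ _ _ _ _ t 0) _.
  apply: orb_trans (orb_swap _ _ _ _ _ _) _.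
  by rewrite /= scaler0 subr0 expr0 mulmx1 mul1mx; exact: orb_refl.
have nz s : (i1 - t *: i2) s 0 != 0.
  rewrite !mxE subr_eq0; have [i20|i2s] := eqVneq (i2 s 0) 0.
    rewrite i20 mulr0; apply/eqP => i10; have := diag_moment _ _ _ _ _ s m1.
    by rewrite i10 i20 !mul0r addr0 => /esym/eqP; rewrite oppr_eq0 (negbTE tau0).
  apply: contra tb => /eqP e; apply/mapP; exists s; first by rewrite mem_enum.
  by rewrite e mulfK.
have m2 := orb_moment o2 m1; apply: (orb_trans o2); move: nz m2.
move: (i1 - t *: i2) (j2 + t *: j1) => {m1 o2 tb}u {}j2 nz m2.
(* Diagonal matrices commute with L, so they can be used to rescale u. *)
pose g := diag_mx (\row_s (u s 0)^-1) : 'M[F]_k.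
have gU : g \in unitmx.
  rewrite unitmxE det_diag unitfE; apply/prodf_neq0 => s _.
  by rewrite mxE invr_eq0.
have gL : g *m L *m invmx g = L by rewrite diag_mxC mulmxK.
have gu : g *m u = const_mx 1.
  by apply/colP => s; rewrite mul_diag_mx !mxE mulVf.
have o3 := orb_gl (mkq L B u i2 j1 j2) gU; rewrite gl_act_mkq gL gu in o3.
have m3 := orb_moment o3 m2; apply: (orb_trans o3); move: m3 {o3 m2}.
move: (g *m B *m _) (g *m i2) (j1 *m _) (j2 *m _) => {}B {}i2 {}j1 {}j2 m3.
have [c cP] := interpolation (fun s => i2 s 0) dI.
have [B' o4] := orb_shear_sum L B (const_mx 1) i2 j1 j2 c k.
have LX n s (v : 'cV_k) : (L ^+ n *m v) s 0 = d s ^+ n * v s 0.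
  by rewrite diag_mxX mul_diag_mx !mxE.
have XL n s (v : 'rV_k) : (v *m L ^+ n) 0 s = v 0 s * d s ^+ n.
  by rewrite diag_mxX mul_mx_diag !mxE.
have i20 : i2 - \sum_(n < k) c n *: (L ^+ n *m const_mx 1) = 0.
  apply/colP => s; rewrite [LHS]mxE [X in _ + X]mxE summxE [RHS]mxE.
  rewrite -cP -sumrB big1 // => n _.
  by rewrite [X in _ - X]mxE LX mxE mulr1 subrr.
rewrite i20 in o4; have m4 := orb_moment o4 m3; apply: (orb_trans o4); move: m4 {o4 m3}.
move: (j1 + _) => {}j1 m4.
have j1E : j1 = const_mx (- tau).
  apply/rowP => s; have := diag_moment _ _ _ _ _ s m4.
  by rewrite !mxE mul1r mul0r addr0.
rewrite {}j1E in m4 *.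
(* The row j1 has no zero entry, so its multiples by polynomials in L fill the space. *)
have [c' c'P] := interpolation (fun s => (w 0 s - j2 0 s) / (- tau)) dI.
have [B'' o5] := orb_coshear_sum L B' (const_mx 1) 0 (const_mx (- tau)) j2 c' k.
have j2w : j2 + \sum_(n < k) c' n *: (const_mx (- tau) *m L ^+ n) = w.
  apply/rowP => s; rewrite [LHS]mxE summxE.
  rewrite (eq_bigr (fun n : 'I_k => (- tau) * (c' n * d s ^+ n))) => [|n _].
    by rewrite -mulr_sumr c'P mulrC divfK ?oppr_eq0 // addrC subrK.
  by rewrite mxE XL mxE mulrCA.
rewrite j2w big1 ?subr0 in o5; last by move=> n _; rewrite mulmx0 scaler0.
have m5 := orb_moment o5 m4; apply: (orb_trans o5).
(* Polynomials in L are exactly the diagonal matrices. *)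
have [e eP] := interpolation (fun s => - B'' s s) dI.
have := orb_translate_sum L B'' (const_mx 1) 0 (const_mx (- tau)) w e k.
suff -> : B'' + \sum_(n < k) e n *: L ^+ n = cm_mx d by [].
apply/matrixP => s r; rewrite mxE summxE.
rewrite (eq_bigr (fun n : 'I_k => (e n * d s ^+ n) *+ (s == r))); last first.
  by move=> n _; rewrite mxE diag_mxX !mxE mulrnAr.
rewrite sumrMnl eP !mxE; have [->|sr] := eqVneq s r; first by rewrite addrN.
rewrite mulr0n addr0; move: m5; rewrite moment_mkq => /matrixP/(_ s r).
rewrite mxE diag_commutator !mxE !big_ord1 !mxE (negbTE sr) mulr0n mul0r addr0 mul1r.
rewrite opprK => /eqP; rewrite addr_eq0 => /eqP <-.
by rewrite [_ * B'' s r]mulrC mulfK // subr_eq0 (inj_eq dI).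
Qed.

End NormalForm.

Section PolePlacement.
Context (F : fieldType) (k : nat).
Implicit Types (d : 'I_k -> F) (w : 'rV[F]_k).

Lemma transfer_diag d w : transfer (diag_mx (\row_s d s)) w (const_mx 1) =
  \sum_s w 0 s *: \prod_(r | r != s) ('X - (d r)%:P).
Proof.
set L := diag_mx _; pose p s := \prod_(r | r != s) ('X - (d r)%:P).
have ZE : char_poly_mx L = diag_mx (\row_s ('X - (d s)%:P)).
  apply/matrixP => s r; rewrite !mxE; case: eqVneq => [->|] //=.
  by rewrite !mulr0n subr0.
rewrite /transfer -/L; have -> : \adj (char_poly_mx L) = diag_mx (\row_s p s).
  apply/esym/adj_unique; first exact: char_poly_neq0.
  rewrite ZE mulmx_diag det_diag; apply/matrixP => s r; rewrite !mxE.
  congr (_ *+ _); rewrite [RHS](bigD1 s) //= mxE /p.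
  by congr (_ * _); apply: eq_bigr => a _; rewrite mxE.
rewrite /pairing mul_mx_diag mxE; apply: eq_bigr => s _.
by rewrite !mxE mulr1 mul_polyC.
Qed.

(** By [transfer_diag] the feedback subtracts from the characteristic polynomial an
    arbitrary combination of the products of the X - d_r for r != s, and these
    products form a basis of the polynomials of degree less than k. *)
Lemma pole_placement d (mu : 'I_k -> F) : injective d -> exists w,
  char_poly (diag_mx (\row_s d s) + (1 : F) *: (const_mx 1 *m w)) =
    \prod_s ('X - (mu s)%:P).
Proof.
move=> dI; pose p s : {poly F} := \prod_(r | r != s) ('X - (d r)%:P).
pose E := \prod_s ('X - (mu s)%:P).
have pd s : (p s).[d s] != 0.
  rewrite horner_prod; apply/prodf_neq0 => r rs.
  by rewrite hornerXsubC subr_eq0 (inj_eq dI) eq_sym.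
have pd0 s r : r != s -> (p r).[d s] = 0.
  by move=> rs; rewrite horner_prod (bigD1 s) 1?eq_sym //= hornerXsubC subrr mul0r.
pose w : 'rV_k := \row_s (- E.[d s] / (p s).[d s]); exists w.
set L := diag_mx _; apply/eqP; rewrite -subr_eq0; apply/eqP.
apply: (@roots_geq_poly_eq0 _ _ [seq d s | s <- enum 'I_k]).
- apply/allP => _ /mapP[s _ ->]; rewrite rootE char_poly_rank1 scale1r transfer_diag.
  have Ls : (char_poly L).[d s] = 0.
    rewrite char_poly_trig ?diag_mx_is_trig // horner_prod (bigD1 s) //=.
    by rewrite !mxE eqxx mulr1n hornerXsubC subrr mul0r.
  have Ts : (\sum_r w 0 r *: p r).[d s] = - E.[d s].
    rewrite horner_sum (bigD1 s) //= big1 => [|r rs].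
      by rewrite addr0 hornerZ mxE divfK.
    by rewrite hornerZ pd0 ?mulr0.
  by rewrite hornerD [(_ - _).[_]]hornerD !hornerN Ls Ts sub0r opprK subrr.
- by rewrite map_inj_uniq ?enum_uniq.
rewrite size_map size_enum_ord.
have sE : size E = k.+1 by rewrite /E -big_enum size_prod_XsubC size_enum_ord.
apply/leq_sizeP => j; rewrite leq_eqVlt coefB => /predU1P[<-|kj]; last first.
  by rewrite !nth_default ?subrr // ?sE ?size_char_poly.
have e1 (M : 'M[F]_k) : (char_poly M)`_k = 1.
  by rewrite -(monicP (char_poly_monic M)) lead_coefE size_char_poly.
have Em : E \is monic := monic_prod_XsubC _ _ _.
have e2 : E`_k = 1 by rewrite -(monicP Em) lead_coefE sE.
by rewrite e1 -/E e2 subrr.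
Qed.

End PolePlacement.

Section Transitivity.
Context (F : numClosedFieldType) (k : nat) (tau : F).

Lemma orb_normal_form q : tau != 0 -> moment q = tau%:M ->
  orb q (normal_form tau (fun s : 'I_k => (s : nat)%:R) 0).
Proof.
move=> tau0 mq; pose mu (s : 'I_k) : F := (s : nat)%:R.
have muI : injective mu.
  by move=> s r /eqP; rewrite Num.Theory.eqr_nat => /eqP/val_inj.
have [q' qq' sep] := separable_in_orbit tau0 mq; apply: (orb_trans qq').
have mq' := orb_moment qq' mq.
have [d dI cA] : exists2 d : 'I_k -> F, injective d &
    char_poly q'.1.1.1 = \prod_s ('X - (d s)%:P).
  move: sep; have := size_char_poly q'.1.1.1.
  have [r ->] := closed_field_poly_normal (char_poly q'.1.1.1).
  rewrite (monicP (char_poly_monic _)) scale1r size_prod_XsubC => -[rk].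
  rewrite separable_prod_XsubC => ur; exists (fun s : 'I_k => r`_s) => [s t /eqP|].
    by rewrite nth_uniq ?rk // => /eqP/val_inj.
  by rewrite (big_nth 0) big_mkord rk.
have [w wE] := pole_placement mu dI.
have o := to_normal_form w dI tau0 mq' cA; apply: (orb_trans o).
have o' := orb_feedback (diag_mx (\row_s d s)) (cm_mx tau d) (const_mx 1) 0
  (const_mx (- tau)) w 1.
apply: (orb_trans o'); apply: to_normal_form => //.
exact: orb_moment o' (orb_moment o mq').
Qed.

Lemma TAut_transitive : tau != 0 -> acts_transitively (@TAut F) (@Nact F k tau).
Proof.
move=> tau0; have muI : injective (fun s : 'I_k => (s : nat)%:R : F).
  by move=> s r /eqP; rewrite Num.Theory.eqr_nat => /eqP/val_inj.
split.
  have /eqP m := normal_form_moment tau 0 muI.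
  by split; exact: (\pi_(Nvar k tau) (exist (fun q => moment q == tau%:M) _ m))%qT.
elim/quotW => p; elim/quotW => q.
have op := orb_normal_form tau0 (eqP (valP p)).
have oq := orb_normal_form tau0 (eqP (valP q)).
have [phi [g [phiT gU e]]] := orb_trans op (orb_sym oq).
exists phi => //; rewrite Nact_pi; apply/eqmodP/asboolP.
by exists g.
Qed.

End Transitivity.

Theorem theorem8p1 (R : realType) (k : nat) (hk : (1 <= k)%N)
    (tau : R[i]) (htau : tau != 0) :
  acts_transitively (@TAut R[i]) (@Nact R[i] k tau).
Proof. exact: TAut_transitive. Qed.
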